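(* Let $S$ be a closed symmetric linear relation in a Krein space $\mathfrak H$ with equal defect numbers $d\in\mathbb N$, and let $\mathsf b:S^*\to\mathbb C^{2d}$ be a boundary mapping for $S$ with Gram matrix $\mathsf Q$. Then the binary relation $$\Xi=\Bigl\{\bigl\{[\widetilde A],[\mathcal P(z)]\bigr\}\;:\;\widetilde A\in\mathbb A_{S,\mathsf b},\ \mathcal P(z)\in\mathbb P_{\mathsf Q},\ T_{\widetilde A}(z)=T_{S,\mathsf b,\mathcal P}(z)\ \text{for all } z\in\mathbb C\Bigr\}$$ is a bijection between the set of equivalence classes $\mathbb A_{S,\mathsf b}/\!\sim$ and the set of equivalence classes $\mathbb P_{\mathsf Q}/\!\sim$.
   Context: Linear relations. A (closed) linear relation $R$ in a Krein space $\mathfrak K$ is a (closed) linear subspace of $\mathfrak K^2$, with elements written $\{f,g\}$; operators are identified with their graphs. The adjoint is $R^*=\{\{h,k\}\in\mathfrak K^2:[g,h]=[f,k]\text{ for all }\{f,g\}\in R\}$; $R$ is symmetric if $R\subseteq R^*$ and self-adjoint if $R=R^*$. Products of relations are compositions. Symmetric relation and boundary mapping. $S$ has equal defect numbers $d\in\mathbb N=\{1,2,\dots\}$ means that $\dim S^*/S=2d$ and the Hermitian form $(\{f,g\},\{h,k\})\mapsto \mathrm i([f,k]-[g,h])$ on $S^*/S$ has $d$ positive and $d$ negative squares. A boundary mapping for $S$ is a linear surjection $\mathsf b:S^*\to\mathbb C^{2d}$ with kernel $S$; its Gram matrix is the invertible self-adjoint $2d\times2d$ matrix $\mathsf Q$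 (with $d$ positive and $d$ negative eigenvalues) such that $\mathrm i([f,k]-[g,h])=\mathsf b(\{h,k\})^*\mathsf Q\,\mathsf b(\{f,g\})$ for all $\{f,g\},\{h,k\}\in S^*$. The class $\mathbb P_{\mathsf Q}$. The degree of a row polynomial is the highest power of $z$ with nonzero coefficient ($-\infty$ for the zero polynomial). $\mathbb P_{\mathsf Q}$ is the set of $d\times2d$ matrix polynomials $\mathcal P(z)$ with row degrees $\mu_j$ such that: (a) $\mathcal P(z)\mathsf Q^{-1}\mathcal P(z^* )^*=0$ for all $z\in\mathbb C$ ($z^*$ is the complex conjugate of $z$); (b) $\operatorname{rank}\mathcal P(z)=d$ for all $z\in\mathbb C$; (c) $\operatorname{rank}\mathsf P_\infty=d$, where $\mathsf P_\infty=\lim_{z\to\infty}\operatorname{diag}(z^{-\mu_1},\dots,z^{-\mu_d})\mathcal P(z)$ is the matrix of leading row coefficients; (d) $\mu_1\ge\cdots\ge\mu_d\ge0$. $\mathcal P(z)\sim\mathcal S(z)$ in $\mathbb P_{\mathsf Q}$ if there is a unimodular $d\times d$ matrix polynomial $\mathcal W(z)$ (determinant a nonzero constant) with $\mathcal S(z)=\mathcal W(z)\mathcal P(z)$ for all $z\in\mathbb C$; $[\mathcal P(z)]$ is the equivalence class. For $z\in\mathbb C$, $T_{S,\mathsf b,\mathcal P}(z)=\{\{f,g\}\in S^*:\mathcal P(z)\mathsf b(\{f,g\})=0\}$. The class $\mathbb A_{S,\mathsf b}$. This is the set of all self-adjoint relations $\widetilde A$ in a Krein space $\widetilde{\mathfrak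 H}$ such that: (a) $\mathfrak H$ is a Krein subspace of $\widetilde{\mathfrak H}$ (so $\widetilde{\mathfrak H}=\mathfrak H\oplus\widehat{\mathfrak H}$ with $\widehat{\mathfrak H}$ the orthogonal complement of $\mathfrak H$); (b) $S\subseteq\widetilde A$; (c) $\dim\widehat{\mathfrak H}<\infty$; (d) $\widehat S=\widetilde A\cap\widehat{\mathfrak H}^2$ is a (closed symmetric) operator without eigenvalues. $\widetilde A$ and $\widehat{\mathfrak H}$ may vary, $\widehat{\mathfrak H}=\{0\}$ is allowed. Two elements satisfy $\widetilde A_1\sim\widetilde A_2$ if there is a Krein space isomorphism (linear, bijective, preserving the inner product) $\Psi:\widehat{\mathfrak H}_1\to\widehat{\mathfrak H}_2$ with $(I_{\mathfrak H}\oplus\Psi)\widetilde A_1=\widetilde A_2(I_{\mathfrak H}\oplus\Psi)$; $[\widetilde A]$ is the equivalence class. Shtraus subspaces. With $\widetilde P_{\mathfrak H}$ the orthogonal projection of $\widetilde{\mathfrak H}$ onto $\mathfrak H$, for $z\in\mathbb C$, $T_{\widetilde A}(z)=\{\{\widetilde P_{\mathfrak H}\widetilde f,\widetilde P_{\mathfrak H}\widetilde g\}:\{\widetilde f,\widetilde g\}\in\widetilde A,\ \widetilde g-z\widetilde f\in\mathfrak H\}$. *)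

(* Defs.v *)
From mathcomp Require Import all_boot all_order all_algebra sesquilinear.
From mathcomp Require Import complex.
From mathcomp Require Import boolp classical_sets functions reals.

Set Implicit Arguments.
Unset Strict Implicit.
Unset Printing Implicit Defensive.

Import Order.TTheory GRing.Theory Num.Theory.

Local Open Scope classical_set_scope.
Local Open Scope ring_scope.
Local Open Scope complex_scope.

(* The scalars are R[i] with R : realType, i.e. the complex numbers; order
   comparisons with 0 in R[i] include the assertion of being real. *)

Section LinearAlgebra.
Context {R : realType} {V : lmodType R[i]}.
Implicit Types D S : set V.

Definition is_subspace D :=
  D 0 /\ forall (a : R[i]) x y, D x -> D y -> D (a *: x + y).

Definition finite_dim D :=
  exists (n : nat) (e : 'I_n -> V),
    (forall i, D (e i)) /\
    (forall x, D x -> exists c : 'cV[R[i]]_n, x = \sum_i c i 0 *: e i).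

(* dim D / S = n: there is a family in D which is a basis modulo S *)
Definition dim_quotient D S (n : nat) :=
  exists e : 'I_n -> V,
    (forall i, D (e i)) /\
    (forall x, D x ->
       exists! c : 'cV[R[i]]_n, S (x - \sum_i c i 0 *: e i)).

(* phi is positive definite on some n-dimensional subspace of D
   (equivalently of D / S, for any S contained in the radical of phi|D) *)
Definition posdef_family (phi : V -> V -> R[i]) D (n : nat) :=
  exists e : 'I_n -> V,
    (forall i, D (e i)) /\
    (forall c : 'cV[R[i]]_n, c != 0 ->
       let x := \sum_i c i 0 *: e i in 0 < phi x x).

Definition positive_squares phi D n :=
  posdef_family phi D n /\ ~ posdef_family phi D n.+1.

Definition negative_squares phi D n :=
  positive_squares (fun x y => - phi x y) D n.

End LinearAlgebra.

Section FundamentalSymmetry.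
Context {R : realType} {V : lmodType R[i]}.
Variable form : {hermitian V for false & (@Num.conj R[i])}.
Implicit Types (J : {linear V -> V}) (u : nat -> V).

(* squared norm of the J-inner product (x, y) |-> [J x, y] *)
Definition sqnorm J (x : V) : R[i] := form (J x) x.

Definition converges J u (l : V) :=
  forall e : R[i], 0 < e ->
    exists N : nat, forall n, (N <= n)%N -> sqnorm J (u n - l) < e.

Definition cauchy J u :=
  forall e : R[i], 0 < e ->
    exists N : nat, forall m n, (N <= m)%N -> (N <= n)%N ->
      sqnorm J (u m - u n) < e.

Definition fundamental_symmetry J :=
  [/\ (forall x, J (J x) = x),
      (forall x y, form (J x) y = form x (J y)),
      (forall x, x != 0 -> 0 < sqnorm J x) &
      (forall u, cauchy J u -> exists l, converges J u l)].

End FundamentalSymmetry.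

Record kreinSpace (R : realType) := KreinSpace {
  krein_sort :> lmodType R[i];
  krein_form : {hermitian krein_sort for false & (@Num.conj R[i])};
  kreinP : exists J : {linear krein_sort -> krein_sort},
             fundamental_symmetry krein_form J
}.

Definition ip {R : realType} {H : kreinSpace R} (x y : H) : R[i] :=
  krein_form H x y.

Section LinearRelations.
Context {R : realType} {H : kreinSpace R}.
Implicit Types T : set (H * H).

(* All fundamental symmetries of a Krein space induce the same topology. *)
Definition closed_relation T :=
  exists J : {linear H -> H}, fundamental_symmetry (krein_form H) J /\
    forall (u v : nat -> H) (f g : H),
      (forall n, T (u n, v n)) ->
      converges (krein_form H) J u f -> converges (krein_form H) J v g ->
      T (f, g).

Definition adjoint T : set (H * H) :=
  [set y | forall x, T x -> ip x.2 y.1 = ip x.1 y.2].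

Definition symmetric_relation T := is_subspace T /\ T `<=` adjoint T.

Definition self_adjoint T := is_subspace T /\ T = adjoint T.

Definition is_operator T := forall g, T (0, g) -> g = 0.

Definition no_eigenvalue T :=
  forall (l : R[i]) (f : H), T (f, l *: f) -> f = 0.

Definition green (x y : H * H) : R[i] := 'i * (ip x.1 y.2 - ip x.2 y.1).

Definition equal_defect T (d : nat) :=
  [/\ dim_quotient (adjoint T) T (2 * d),
      positive_squares green (adjoint T) d &
      negative_squares green (adjoint T) d].

End LinearRelations.

Definition rel_comp {A B C : Type} (U : set (B * C)) (T : set (A * B)) :
    set (A * C) :=
  [set x | exists h, T (x.1, h) /\ U (h, x.2)].

Section MatrixPolynomials.
Context {R : realType}.

Definition ctrans {m n} (A : 'M[R[i]]_(m, n)) : 'M[R[i]]_(n, m) :=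
  map_mx (@Num.conj R[i]) A^T.

Definition mxeval {m n} (P : 'M[{poly R[i]}]_(m, n)) (z : R[i]) :
    'M[R[i]]_(m, n) :=
  map_mx (fun p => p.[z]) P.

(* 1 + the degree of the i-th row, and 0 if the degree is -oo *)
Definition row_size {m n} (P : 'M[{poly R[i]}]_(m, n)) (i : 'I_m) : nat :=
  (\max_(j < n) size (P i j))%N.

Definition lead_row_mx {m n} (P : 'M[{poly R[i]}]_(m, n)) : 'M[R[i]]_(m, n) :=
  \matrix_(i, j) (P i j)`_(row_size P i).-1.

Definition PQ {d : nat} (Q : 'M[R[i]]_(2 * d))
    (P : 'M[{poly R[i]}]_(d, 2 * d)) :=
  [/\ (forall z, mxeval P z *m invmx Q *m ctrans (mxeval P (Num.conj z)) = 0),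
      (forall z, \rank (mxeval P z) = d),
      \rank (lead_row_mx P) = d,
      (forall i j : 'I_d, (i <= j)%N -> (row_size P j <= row_size P i)%N) &
      (forall i, (0 < row_size P i)%N)].

Definition unimodular {d : nat} (W : 'M[{poly R[i]}]_d) :=
  exists2 c : R[i], c != 0 & \det W = c%:P.

Definition PQ_equiv {d : nat} (Q : 'M[R[i]]_(2 * d))
    (P1 P2 : {P : 'M[{poly R[i]}]_(d, 2 * d) | PQ Q P}) :=
  exists2 W : 'M[{poly R[i]}]_d, unimodular W &
    forall z, mxeval (sval P2) z = mxeval W z *m mxeval (sval P1) z.

End MatrixPolynomials.

Section BoundaryMappings.
Context {R : realType} {H : kreinSpace R}.
Implicit Types (S : set (H * H)) (d : nat).

(* b is a function on all of H * H, but only its restriction to S^* matters *)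
Definition boundary_mapping S d (b : H * H -> 'cV[R[i]]_(2 * d)) :=
  [/\ (forall (a : R[i]) x y, adjoint S x -> adjoint S y ->
         b (a *: x + y) = a *: b x + b y),
      (forall c, exists2 x, adjoint S x & b x = c) &
      (forall x, adjoint S x -> (b x = 0 <-> S x))].

(* eigenvalues are counted with multiplicity *)
Definition inertia n (Q : 'M[R[i]]_n) (p q : nat) :=
  exists s : seq R[i],
    [/\ char_poly Q = \prod_(a <- s) ('X - a%:P),
        count (fun a => 0 < a) s = p & count (fun a => a < 0) s = q].

Definition gram_matrix S d (b : H * H -> 'cV[R[i]]_(2 * d))
    (Q : 'M[R[i]]_(2 * d)) :=
  [/\ Q \in unitmx, ctrans Q = Q, inertia Q d d &
      forall x y, adjoint S x -> adjoint S y ->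
        green x y = (ctrans (b y) *m Q *m b x) 0 0].

Definition T_poly S d (b : H * H -> 'cV[R[i]]_(2 * d))
    (P : 'M[{poly R[i]}]_(d, 2 * d)) (z : R[i]) : set (H * H) :=
  [set x | adjoint S x /\ mxeval P z *m b x = 0].

End BoundaryMappings.

Arguments boundary_mapping {R H} S {d} b.
Arguments gram_matrix {R H} S {d} b Q.
Arguments T_poly {R H} S {d} b P z _.

Section Extensions.
Context {R : realType} {H : kreinSpace R}.

(* the orthogonal complement of the range of iota *)
Definition ortho_compl {K : kreinSpace R} (iota : H -> K) : set K :=
  [set x | forall h, ip (iota h) x = 0].

(* Elements of the class A_{S,b}, which depends on S only. The inclusion of H
   in the larger Krein space is an isometric embedding ext_inj; that its range
   is a Krein subspace is expressed by ext_decomp: the larger space is the sum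
   of the range and its orthogonal complement. *)
Record extension (S : set (H * H)) := Extension {
  ext_space : kreinSpace R;
  ext_inj : {linear H -> ext_space};
  ext_rel : set (ext_space * ext_space);
  ext_isometry : forall x y, ip (ext_inj x) (ext_inj y) = ip x y;
  ext_decomp : forall x, exists h, ortho_compl ext_inj (x - ext_inj h);
  ext_selfadj : self_adjoint ext_rel;
  ext_extends : forall x, S x -> ext_rel (ext_inj x.1, ext_inj x.2);
  ext_findim : finite_dim (ortho_compl ext_inj);
  ext_minimal :
    let Shat := ext_rel `&` (ortho_compl ext_inj `*` ortho_compl ext_inj) in
    is_operator Shat /\ no_eigenvalue Shat
}.

Arguments ext_rel {S} e _.

Definition krein_iso {K1 K2 : kreinSpace R} (D1 : set K1) (D2 : set K2)
    (Psi : K1 -> K2) :=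
  [/\ (forall (a : R[i]) x y, D1 x -> D1 y ->
         Psi (a *: x + y) = a *: Psi x + Psi y),
      set_bij D1 D2 Psi &
      (forall x y, D1 x -> D1 y -> ip (Psi x) (Psi y) = ip x y)].

(* the graph of I (+) Psi *)
Definition graph_id_sum {K1 K2 : kreinSpace R}
    (i1 : H -> K1) (i2 : H -> K2) (Psi : K1 -> K2) : set (K1 * K2) :=
  [set x | exists (h : H) (y : K1),
     ortho_compl i1 y /\ x = (i1 h + y, i2 h + Psi y)].

Definition ext_equiv (S : set (H * H)) (A1 A2 : extension S) :=
  exists Psi : ext_space A1 -> ext_space A2,
    krein_iso (ortho_compl (ext_inj A1)) (ortho_compl (ext_inj A2)) Psi /\
    let U := graph_id_sum (ext_inj A1) (ext_inj A2) Psi in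
    rel_comp U (ext_rel A1) = rel_comp (ext_rel A2) U.

(* h is the orthogonal projection of x onto H *)
Definition is_proj (S : set (H * H)) (A : extension S)
    (x : ext_space A) (h : H) :=
  ortho_compl (ext_inj A) (x - ext_inj A h).

Definition T_ext (S : set (H * H)) (A : extension S) (z : R[i]) :
    set (H * H) :=
  [set y | exists f g : ext_space A,
     [/\ ext_rel A (f, g), range (ext_inj A) (g - z *: f),
         is_proj f y.1 & is_proj g y.2]].

End Extensions.

(* e is meant to be an equivalence relation *)
Definition eqv_class {T : Type} (e : T -> T -> Prop) : Type :=
  {c : T -> Prop | exists x, c = e x}.

Definition class_of {T : Type} (e : T -> T -> Prop) (x : T) : eqv_class e :=
  exist _ (e x) (ex_intro _ x erefl).

Definition bijective_relation {A B : Type} (X : A -> B -> Prop) :=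
  (forall a, exists! b, X a b) /\ (forall b, exists! a, X a b).

Definition Xi {R : realType} {H : kreinSpace R} {d : nat} (S : set (H * H))
    (b : H * H -> 'cV[R[i]]_(2 * d)) (Q : 'M[R[i]]_(2 * d))
    (alpha : eqv_class (@ext_equiv R H S)) (beta : eqv_class (PQ_equiv (Q := Q))) :=
  exists A P, [/\ alpha = class_of _ A, beta = class_of _ P &
                  forall z, T_ext A z = T_poly S b (sval P) z].

Arguments Xi {R H d} S b Q alpha beta.

(* Main.v *)
(* Every extension contains S and lies in the sum of S^* and the square of the
   finite-dimensional complement, so modulo S it is a Lagrangian subspace of a
   finite-dimensional space: the boundary values C^2d plus two copies of C^n.
   By self-adjointness, minimality of the extension means that the pencil
   g - z f is onto on this subspace for every z, infinity included; consequently
   its kernels at infinitely many z already span the subspace.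

   An extension gives the module of polynomial rows p with p(z) b = 0 on T(z) for
   all z; a basis of this module with minimal row degrees is a matrix in P_Q, and
   two such bases differ by a unimodular factor. Conversely, P in P_Q acts on the
   space of polynomial vectors with row degrees below those of P, by
   g(z) = z f(z) + P(z) c; the identity P(z) Q^-1 P(z^* )^* = 0 gives it an
   indefinite inner product with reproducing kernel P(z) Q^-1 P(w)^* / (z - w^* )
   up to a constant factor. Two extensions with equal Shtraus subspaces are
   unitarily equivalent because vectors in the kernels at z and w have inner
   product determined by their boundary values whenever z and w are not
   conjugate. *)

Require Import Defs.
From HB Require Import structures.
From mathcomp Require Import all_boot all_order all_algebra perm sesquilinear spectral.
From mathcomp Require Import complex.
From mathcomp Require Import zify ring lra.
From mathcomp Require Import boolp classical_sets reals.

Set Implicit Arguments.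
Unset Strict Implicit.
Unset Printing Implicit Defensive.

Import Order.TTheory GRing.Theory Num.Theory.
Local Open Scope classical_set_scope.
Local Open Scope ring_scope.
Local Open Scope complex_scope.

(** Both sides are tied together by dimension counts. A Lagrangian subspace of the
    (2d+2n)-dimensional coordinate space has dimension d+n and is its own annihilator. If the pencil
    at z were not onto, a vector orthogonal to its range would give an eigenvector at the conjugate
    of z, or, at infinity, an element {0, g}; both are excluded by [ext_minimal]. Hence every
    Shtraus subspace has dimension exactly d, which matches the rank clauses of [PQ]: rank d at each
    finite z, and rank d of the leading row matrix at infinity.

    The obstacle in the converse direction is the inner product, since the kernel is a quotient of
    polynomials in two variables. It is avoided by prescribing the Gram matrix only on kernel
    vectors at the nodes i(k+1): they span, no two nodes are conjugate, and so each division is by a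
    nonzero number. The same nodes serve for uniqueness.

    Boundary values are written as rows, so that subspaces become row spaces; this is why Q enters
    as its transpose. *)

Section RowSpaces.
Context {F : fieldType}.

(** Turns a subspace given by a predicate into a row space, so that rank arguments apply. A free
    family in [D] of maximal size spans [D], since a vector outside its span could be appended to
    it. *)
Lemma row_subspaceP m (D : 'rV[F]_m -> Prop) :
    D 0 -> (forall a u v, D u -> D v -> D (a *: u + v)) ->
  exists r (B : 'M[F]_(r, m)), row_free B /\ forall v, D v <-> (v <= B)%MS.
Proof.
move=> D0 Dlin.
pose ok r := `[< exists B : 'M[F]_(r, m), row_free B /\ forall i, D (row i B) >].
have ok0 : exists r, ok r.
  exists 0%N; apply/asboolP; exists 0; split; first by rewrite /row_free mxrank0.
  by case.
have okm r : ok r -> (r <= m)%N.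
  by move=> /asboolP[B [/eqP Bfree _]]; rewrite -{1}Bfree rank_leq_col.
case: (ex_maxnP ok0 okm) => r /asboolP[B [Bfree DB]] rmax.
have DBv v : (v <= B)%MS -> D v.
  move=> /submxP[u ->]; rewrite mulmx_sum_row.
  by elim/big_ind: _ => // [x y Dx Dy|i _];
    [rewrite -[x]scale1r; apply: Dlin | rewrite -[X in D X]addr0; apply: Dlin].
exists r, B; split=> // v; split; last exact: DBv.
move=> Dv; apply: contraT => vB.
suff /rmax : ok r.+1 by rewrite ltnn.
rewrite -addn1; apply/asboolP; exists (col_mx B v); split; last first.
  move=> i; rewrite -(splitK i); case: (split i) => j /=.
    by rewrite rowKu.
  by rewrite rowKd row_id.
rewrite -row_leq_rank -addsmxE.
suff : (\rank B < \rank (B + v)%MS)%N by rewrite (eqP Bfree) addn1.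
rewrite ltn_neqAle mxrankS ?addsmxSl // andbT.
apply: contra vB => /eqP rE; rewrite (submx_trans (addsmxSr B v)) //.
by have [_] := mxrank_leqif_eq (addsmxSl B v); rewrite rE eqxx => /esym/andP[].
Qed.

End RowSpaces.

(** * Matrix pencils *)

Section Pencils.
Context {F : closedFieldType}.

Lemma exists_eigenvector n (N : 'M[F]_n) : (0 < n)%N ->
  exists (z : F) (u : 'cV_n), u != 0 /\ N *m u = z *: u.
Proof.
move=> n_gt0.
have /closed_rootP[z] : size (char_poly N^T) != 1%N.
  by rewrite size_char_poly eqSS -lt0n.
rewrite -eigenvalue_root_char => /eigenvalueP[v vN v0].
exists z, v^T; split.
  by rewrite trmx_eq0.
by apply: trmx_inj; rewrite trmx_mul trmxK vN linearZ /= trmxK.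
Qed.

Lemma pencil_kernels_span l n (E G : 'M[F]_(l, n)) (z : nat -> F) :
    injective z -> row_full E -> (forall a, row_full (G - a *: E)) ->
  exists K, (1%:M <= \sum_(k < K) kermx (G - z k *: E))%MS.
Proof.
(* Modulo the span L0 of the kernels and its image L0 E, the pencil becomes
   square (G - z_k E maps L0 onto L0 E for a suitable node z_k) with E
   invertible, so it would have an eigenvalue unless the quotients vanish. The
   argument runs on the annihilator Y of L0 E. *)
move=> z_inj Efull pfull; exists n.+1.
set L0 := (\sum_(k < _) _)%MS.
have kerL0 (k : 'I_n.+1) : (kermx (G - z k *: E) <= L0)%MS.
  exact: (sumsmx_sup k).
have GE : (L0 *m G <= L0 *m E)%MS.
  have /sub_sumsmxP[u L0E] : (L0 <= L0)%MS by [].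
  rewrite {1}L0E mulmx_suml; apply/summx_sub => k _.
  have kG : kermx (G - z k *: E) *m G = z k *: (kermx (G - z k *: E) *m E).
    apply/eqP; rewrite -subr_eq0 scalemxAr -mulmxBr; exact/eqP/mulmx_ker.
  rewrite -mulmxA kG -scalemxAr scalemx_sub // mulmxA submxMr //.
  exact: (mulmx_sub _ (kerL0 k)).
set s := \rank (L0 *m E).
(* Compressed by [A] and [D], the matrix [L0 E] becomes the identity of size s. The nodes at which
   the compressed pencil is singular are then roots of a characteristic polynomial of degree s <= n,
   and there are n+1 nodes. *)
have [k rk] : exists k : 'I_n.+1, (s <= \rank (L0 *m (G - z k *: E)))%N.
  set M := L0 *m E; pose A := pinvmx (col_base M); pose D := pinvmx (row_base M).
  have AMD : A *m M *m D = 1%:M.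
    transitivity (A *m (col_base M *m row_base M) *m D); first by rewrite mulmx_base.
    by rewrite mulmxA mulVpmx ?col_base_full // mul1mx mulmxVp ?row_base_free.
  pose p := char_poly (A *m (L0 *m G) *m D).
  have pn0 : p != 0 by rewrite -size_poly_gt0 size_char_poly.
  have [k pk] : exists k : 'I_n.+1, ~~ root p (z k).
    apply/existsP; apply: contraT; rewrite negb_exists => /forallP allr.
    have := @max_poly_roots _ p [seq z k | k : 'I_n.+1 <- enum 'I_n.+1] pn0.
    rewrite size_map size_enum_ord size_char_poly ltnS => H.
    suff : (n.+1 <= s)%N by rewrite ltnNge rank_leq_col.
    apply: H; last by rewrite map_inj_uniq ?enum_uniq // => i j /z_inj/val_inj.
    by apply/allP => _ /mapP[k _ ->]; have := allr k; rewrite negbK.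
  exists k; have := pk; rewrite -eigenvalue_root_char.
  rewrite /eigenvalue /eigenspace kermx_eq0 negbK -row_leq_rank => /leq_trans; apply.
  rewrite -scalemx1 -AMD.
  have -> : A *m (L0 *m G) *m D - z k *: (A *m M *m D)
      = A *m (L0 *m (G - z k *: E)) *m D.
    by rewrite mulmxBr !mulmxBr mulmxBl -!scalemxAr -scalemxAl.
  by apply: leq_trans (mxrankM_maxl _ _) (mxrankM_maxr _ _).
have rkL0 : (s + (l - n) <= \rank L0)%N.
  rewrite -(mxrank_mul_ker L0 (G - z k *: E)) leq_add //.
  have <- : \rank (kermx (G - z k *: E)) = (l - n)%N.
    by rewrite mxrank_ker (eqP (pfull _)).
  by rewrite mxrankS // sub_capmx kerL0 submx_refl.
have ln : (n <= l)%N by rewrite -(eqP Efull) rank_leq_row.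
suff sn : s = n.
  by rewrite sub1mx /row_full eqn_leq rank_leq_col (leq_trans _ rkL0) // sn subnKC.
have Einj p (Y : 'M_(n, p)) : E *m Y = 0 -> Y = 0.
  by move=> EY; rewrite -[Y]mul1mx -(mulVpmx Efull) -mulmxA EY mulmx0.
pose Y := col_base (cokermx (L0 *m E)).
have YE : L0 *m E *m Y = 0.
  apply: (row_free_inj (row_base_free (cokermx (L0 *m E)))).
  by rewrite mul0mx -mulmxA mulmx_base mulmx_coker.
have YG : L0 *m G *m Y = 0.
  by have /submxP[u ->] := GE; rewrite -mulmxA YE mulmx0.
have Yinj q (u : 'M_(_, q)) : Y *m u = 0 -> u = 0.
  by move=> Yu; rewrite -[u]mul1mx -(mulVpmx (col_base_full _)) -mulmxA Yu mulmx0.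
have annE X : L0 *m X = 0 -> (X^T <= kermx L0^T)%MS.
  by move=> L0X; apply/sub_kermxP; rewrite -trmx_mul L0X trmx0.
have EYS : ((E *m Y)^T <= kermx L0^T)%MS by apply: annE; rewrite mulmxA YE.
have EYker : ((E *m Y)^T == kermx L0^T)%MS.
  have [_ <-] := mxrank_leqif_eq EYS; rewrite eqn_leq mxrankS //=.
  rewrite mxrank_ker !mxrank_tr.
  have -> : \rank (E *m Y) = (n - s)%N.
    rewrite -mxrank_coker; apply/eqP; rewrite -mxrank_tr -/(row_free _).
    rewrite -kermx_eq0; apply/eqP/row_matrixP => i; rewrite row0.
    set v := row i _; have : v *m (E *m Y)^T = 0.
      by apply/sub_kermxP; rewrite row_sub.
    move/(congr1 trmx); rewrite trmx_mul trmxK trmx0 -mulmxA => /Einj/Yinj.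
    by move/(congr1 trmx); rewrite trmxK trmx0.
  rewrite leq_subLR; apply: leq_trans (leq_add rkL0 (leqnn _)).
  by rewrite addnAC subnKC ?rank_leq_col // subnKC.
(* The columns of [G Y] also annihilate [L0], so on the quotients the pencil is [N^T - a] up to the
   factor [E Y]. An eigenvector of [N^T] would contradict that [G - a E] has full column rank, so
   [Y] has no columns. *)
have /submxP[N NE] : ((G *m Y)^T <= (E *m Y)^T)%MS.
  by rewrite (eqmxP EYker); apply: annE; rewrite mulmxA YG.
have {NE} NE : G *m Y = E *m Y *m N^T.
  by apply: trmx_inj; rewrite NE [RHS]trmx_mul trmxK.
apply/eqP; rewrite eqn_leq rank_leq_col /= -subn_eq0 -mxrank_coker.
apply: contraT; rewrite -lt0n => /(exists_eigenvector N^T)[a [u [u0 Nu]]].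
case/negP: u0; apply/eqP/Yinj.
rewrite -[LHS]mul1mx -(mulVpmx (pfull a)) -mulmxA mulmxBl -scalemxAl.
by rewrite [G *m _]mulmxA [E *m _]mulmxA NE -mulmxA Nu -scalemxAr subrr mulmx0.
Qed.

End Pencils.

(** * Polynomial matrices *)

Lemma poly_eq0_seq (F : idomainType) (z : nat -> F) (p : {poly F}) :
  injective z -> (forall k, p.[z k] = 0) -> p = 0.
Proof.
move=> zinj pz; apply/eqP; apply: contraT => p0.
have := @max_poly_roots _ p [seq z k | k <- iota 0 (size p)] p0.
rewrite size_map size_iota ltnn => ->//.
  by apply/allP => _ /mapP[k _ ->]; rewrite rootE pz.
by rewrite map_inj_uniq ?iota_uniq.
Qed.

Lemma rank_lt_ker (F : fieldType) d m (A : 'M[F]_(d, m)) :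
  \rank A != d -> exists2 u : 'rV_d, u != 0 & u *m A = 0.
Proof.
rewrite -/(row_free A) -kermx_eq0 => /rowV0Pn[u uk u0].
by exists u => //; apply/sub_kermxP.
Qed.

Section PolynomialMatrices.
Context {R : realType}.
Local Notation C := R[i].
Local Notation "A ^:C" := (map_mx polyC A) (at level 2, left associativity, format "A ^:C").

Lemma mxevalM m n p (A : 'M[{poly C}]_(m, n)) (B : 'M_(n, p)) z :
  mxeval (A *m B) z = mxeval A z *m mxeval B z.
Proof. exact: (map_mxM (horner_eval z)). Qed.

Lemma mxevalD m n (A B : 'M[{poly C}]_(m, n)) z :
  mxeval (A + B) z = mxeval A z + mxeval B z.
Proof. exact: (map_mxD (horner_eval z)). Qed.

Lemma mxevalB m n (A B : 'M[{poly C}]_(m, n)) z :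
  mxeval (A - B) z = mxeval A z - mxeval B z.
Proof. exact: (map_mxB (horner_eval z)). Qed.

Lemma mxevalZ m n (p : {poly C}) (A : 'M[{poly C}]_(m, n)) z :
  mxeval (p *: A) z = p.[z] *: mxeval A z.
Proof. by apply/matrixP => i j; rewrite !mxE hornerM. Qed.

Lemma mxeval0 m n z : mxeval (0 : 'M[{poly C}]_(m, n)) z = 0.
Proof. exact: (map_mx0 (horner_eval z)). Qed.

Lemma mxeval_scalar n (p : {poly C}) z : mxeval (p%:M : 'M_n) z = p.[z]%:M.
Proof. exact: (map_scalar_mx (horner_eval z)). Qed.

Lemma mxevalC m n (A : 'M[C]_(m, n)) z : mxeval A^:C z = A.
Proof. by apply/matrixP => i j; rewrite !mxE hornerC. Qed.

Lemma mxeval_tr m n (A : 'M[{poly C}]_(m, n)) z : mxeval A^T z = (mxeval A z)^T.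
Proof. by apply/matrixP => i j; rewrite !mxE. Qed.

Lemma mxeval_seq_inj m n (A B : 'M[{poly C}]_(m, n)) (z : nat -> C) :
  injective z -> (forall k, mxeval A (z k) = mxeval B (z k)) -> A = B.
Proof.
move=> zinj AB; apply/matrixP => i j; apply/eqP; rewrite -subr_eq0; apply/eqP.
apply: (poly_eq0_seq zinj) => k; rewrite hornerD hornerN.
by have /matrixP/(_ i j) := AB k; rewrite !mxE => ->; rewrite subrr.
Qed.

Lemma mxeval_inj m n (A B : 'M[{poly C}]_(m, n)) :
  (forall z, mxeval A z = mxeval B z) -> A = B.
Proof.
move=> AB; apply: (@mxeval_seq_inj _ _ _ _ (fun k => k%:R)) => // j k /eqP.
by rewrite eqr_nat => /eqP.
Qed.

Lemma mxeval_det n (A : 'M[{poly C}]_n) z : (\det A).[z] = \det (mxeval A z).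
Proof. exact: (esym (det_map_mx (horner_eval z) A)). Qed.

Lemma mxeval_eq0_factor m n (A : 'M[{poly C}]_(m, n)) z :
  mxeval A z = 0 -> exists B, A = ('X - z%:P) *: B.
Proof.
move=> Az; exists (map_mx (fun p => p %/ ('X - z%:P)) A).
apply/matrixP => i j; rewrite !mxE mulrC divpK // dvdp_XsubCl rootE.
by have /matrixP/(_ i j) := Az; rewrite !mxE => ->.
Qed.

Lemma scalepoly_inj m n (p : {poly C}) (A B : 'M[{poly C}]_(m, n)) :
  p != 0 -> p *: A = p *: B -> A = B.
Proof.
move=> p0 AB; apply/matrixP => i j; have /matrixP/(_ i j) := AB.
by rewrite !mxE; apply: mulfI.
Qed.

Lemma row_free_mul_eq0 (F : fieldType) k d m (A : 'M[F]_(d, m)) (U : 'M_(k, d)) :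
  row_free A -> U *m A = 0 -> U = 0.
Proof. by move=> Af UA; apply: (row_free_inj Af); rewrite UA mul0mx. Qed.

Lemma polymx_factor k d m (P : 'M[{poly C}]_(d, m)) (P2 : 'M[{poly C}]_(k, m)) :
    (forall z, \rank (mxeval P z) = d) ->
    (forall z, (mxeval P2 z <= mxeval P z)%MS) ->
  exists W, P2 = W *m P.
Proof.
(* Cramer's rule gives p *: P2 = U *m P for some p != 0; at a root of p the
   matrix U vanishes because P has full rank there, so the root cancels. *)
move=> Prk P2P.
have Pfree z : row_free (mxeval P z) by rewrite /row_free Prk.
have cancel s (p : {poly C}) (U : 'M_(k, d)) : (size p <= s)%N -> p != 0 ->
    p *: P2 = U *m P -> exists W, P2 = W *m P.
  elim: s p U => [|s IHs] p U; first by rewrite leqn0 size_poly_eq0 => /eqP->; rewrite eqxx.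
  move=> ps p0 pU; have [/eqP sp1|] := eqVneq (size p) 1%N.
    have [c c0 pE] := size_poly1P _ sp1.
    exists (c^-1%:P *: U); rewrite -scalemxAl -pU scalerA pE -polyCM mulVf //.
    by rewrite scale1r.
  move=> /closed_rootP[z /factor_theorem[q pE]].
  have Uz : mxeval U z = 0.
    apply: (row_free_mul_eq0 (Pfree z)); rewrite -mxevalM -pU mxevalZ.
    by rewrite pE !hornerE subrr mulr0 scale0r.
  have [V UE] := mxeval_eq0_factor Uz.
  have q0 : q != 0 by apply: contra_neq p0 => q0; rewrite pE q0 mul0r.
  apply: (IHs q V) => //; first by move: ps; rewrite pE size_mul ?polyXsubC_eq0 // size_XsubC addn2.
  apply: (@scalepoly_inj _ _ ('X - z%:P)); first by rewrite polyXsubC_eq0.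
  by rewrite scalerA mulrC -pE pU UE scalemxAl.
(* A constant right inverse of P at 0 makes P D square with determinant 1 at 0; this determinant is
   the nonzero [p] to start from. *)
pose D := (pinvmx (mxeval P 0))^:C.
pose M := P *m D.
have det0 : (\det M).[0] = 1.
  by rewrite mxeval_det mxevalM mxevalC mulmxVp // det1.
apply: (cancel _ (\det M) (P2 *m D *m \adj M)) => //.
  by apply: contra_eq_neq det0 => ->; rewrite horner0 eq_sym oner_eq0.
apply: mxeval_inj => z; have /submxP[w P2z] := P2P z.
transitivity (w *m mxeval (M *m \adj M *m P) z).
  by rewrite mul_mx_adj mul_scalar_mx !mxevalZ P2z scalemxAr.
by rewrite !mxevalM P2z !mulmxA.
Qed.

Definition poly_free d m (P : 'M[{poly C}]_(d, m)) :=
  forall w : 'rV_d, w *m P = 0 -> w = 0.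

Definition replace_row d m (P : 'M[{poly C}]_(d, m)) j (r : 'rV_m) :=
  \matrix_i (if i == j then r else row i P).

(** Steinitz exchange over a ring: neither [a] nor [w 0 j] need be a unit, so a relation among the
    new rows is first multiplied by [a] and then rewritten as the relation [u] among the old
    ones. *)
Lemma poly_free_replace d m (P : 'M[{poly C}]_(d, m)) j (r : 'rV_m)
    (a : {poly C}) (w : 'rV_d) :
  poly_free P -> a != 0 -> a *: r = w *m P -> w 0 j != 0 ->
  poly_free (replace_row P j r).
Proof.
move=> Pfree a0 ar wj v vP.
pose u := v 0 j *: w + a *: \row_i (if i == j then 0 else v 0 i).
have /Pfree u0 : u *m P = 0.
  rewrite mulmxDl -!scalemxAl -ar scalerA mulrC -scalerA -scalerDr.
  rewrite -[RHS](scaler0 _ a); congr (_ *: _); rewrite -{}vP.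
  rewrite !mulmx_sum_row [RHS](bigD1 j) //= rowK eqxx; congr (_ + _).
  rewrite (bigD1 j) //= mxE eqxx scale0r add0r.
  by apply: eq_bigr => i /negPf ij; rewrite mxE ij rowK ij.
have vj : v 0 j = 0.
  have /rowP/(_ j) := u0; rewrite !mxE eqxx mulr0 addr0 => /eqP.
  by rewrite mulf_eq0 (negPf wj) orbF => /eqP.
apply/rowP => i; rewrite mxE; have [->//|ij] := eqVneq i j.
have /rowP/(_ i) := u0; rewrite !mxE (negPf ij) vj mul0r add0r => /eqP.
by rewrite mulf_eq0 (negPf a0) => /eqP.
Qed.

Lemma row_size_replace d m (P : 'M[{poly C}]_(d, m)) j (r : 'rV_m) :
  (row_size r ord0 < row_size P j)%N ->
  (\sum_i row_size (replace_row P j r) i < \sum_i row_size P i)%N.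
Proof.
move=> rj; rewrite (bigD1 j) // [ltnRHS](bigD1 j) //=.
have -> : row_size (replace_row P j r) j = row_size r ord0.
  by apply: eq_bigr => k _; rewrite mxE eqxx.
rewrite (eq_bigr (row_size P)) ?ltn_add2r // => i /negPf ij.
by apply: eq_bigr => k _; rewrite mxE ij mxE.
Qed.

Lemma row_size_ltP m (r : 'rV[{poly C}]_m) s :
  (0 < s)%N -> (forall k, (size (r ord0 k) < s)%N) -> (row_size r ord0 < s)%N.
Proof.
case: s => // s _ rs; rewrite ltnS; apply/bigmax_leqP => k _; exact: rs.
Qed.

Lemma poly_free_row_size_gt0 d m (P : 'M[{poly C}]_(d, m)) j :
  poly_free P -> (0 < row_size P j)%N.
Proof.
move=> Pfree; rewrite lt0n; apply/eqP => Pj.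
have /Pfree j0 : (delta_mx 0 j : 'rV_d) *m P = 0.
  rewrite -rowE; apply/rowP => k; rewrite !mxE; apply/eqP.
  by rewrite -size_poly_leq0 -Pj (leq_bigmax k).
by have /rowP/(_ j) := j0; rewrite !mxE !eqxx => /eqP; rewrite oner_eq0.
Qed.

Lemma size_row_size d m (P : 'M[{poly C}]_(d, m)) i k :
  (size (P i k) <= row_size P i)%N.
Proof. exact: (leq_bigmax k). Qed.

(* D is a module of polynomial rows in which factors X - z can be cancelled. As
   long as P drops rank at some z or its leading row matrix is singular, one of
   its rows can be replaced by an element of D of smaller degree. *)
Section MinimalBasis.
Variables (d m : nat) (D : 'rV[{poly C}]_m -> Prop).
Hypothesis D0 : D 0.
Hypothesis Dlin : forall a p q, D p -> D q -> D (a *: p + q).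
Hypothesis Dsat : forall z p, D (('X - z%:P) *: p) -> D p.

Let Dmul (w : 'rV_d) (P : 'M[{poly C}]_(d, m)) :
  (forall i, D (row i P)) -> D (w *m P).
Proof.
move=> DP; rewrite mulmx_sum_row; elim/big_ind: _ => // [x y Dx Dy|i _].
  by rewrite -[x]scale1r; apply: Dlin.
by rewrite -[X in D X]addr0; apply: Dlin.
Qed.

Let max_support (P : 'M[{poly C}]_(d, m)) (u : 'rV[C]_d) : u != 0 ->
  exists2 j, u 0 j != 0 & forall i, u 0 i != 0 -> (row_size P i <= row_size P j)%N.
Proof.
move=> u0; have /existsP[i0 ui0] : [exists i, u 0 i != 0].
  apply: contraR u0 => /existsPn u0; apply/eqP/rowP => i; rewrite mxE.
  by have := u0 i; rewrite negbK => /eqP.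
by exists [arg max_(i > i0 | u 0 i != 0) row_size P i]; case: arg_maxnP.
Qed.

Let descend (P : 'M[{poly C}]_(d, m)) :
    (forall i, D (row i P)) -> poly_free P ->
    ~ ((forall z, \rank (mxeval P z) = d) /\ \rank (lead_row_mx P) = d) ->
  exists j (r : 'rV_m) (a : {poly C}) (w : 'rV_d),
    [/\ D r, a != 0, a *: r = w *m P, w ord0 j != 0 & (row_size r ord0 < row_size P j)%N].
Proof.
move=> DP Pfree; have Ppos j := poly_free_row_size_gt0 j Pfree.
(* In both cases [j] has the largest row size among the rows that occur in the singular combination
   [u], so the combination has degree at most that of row j before anything is cancelled. *)
move=> /not_andP[/existsNP[z /eqP/rank_lt_ker[u u0 uP]]|/eqP/rank_lt_ker[u u0 uP]];
    have [j uj umax] := max_support P u0; exists j.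
  (* The combination vanishes at z, and dividing by X - z lowers its degree by one. *)
  have : mxeval (u^:C *m P) z = 0 by rewrite mxevalM mxevalC uP.
  move=> /mxeval_eq0_factor[r rE]; exists r, ('X - z%:P), u^:C; split=> //.
  - by apply: (Dsat (z := z)); rewrite -rE; apply: Dmul.
  - by rewrite polyXsubC_eq0.
  - by rewrite mxE polyC_eq0.
  apply: row_size_ltP => // k.
  have [->|rk0] := eqVneq (r 0 k) 0; first by rewrite size_poly0.
  have <- : size ((u^:C *m P) 0 k) = (size (r 0 k)).+1.
    by rewrite rE mxE size_mul ?polyXsubC_eq0 // size_XsubC.
  rewrite mxE; apply: leq_trans (size_sum _ _ _) _; apply/bigmax_leqP => i _.
  rewrite mxE; have [->|ui] := eqVneq (u 0 i) 0; first by rewrite mul0r size_poly0.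
  rewrite mul_polyC; apply: leq_trans (size_scale_leq _ _) _.
  exact: leq_trans (size_row_size _ _ _) (umax _ ui).
(* The powers of X raise all rows to the degree of row j; the coefficient there is then
   [u *m lead_row_mx P], which is zero. *)
pose w : 'rV[{poly C}]_d := \row_i ((u 0 i)%:P * 'X^(row_size P j - row_size P i)).
exists (w *m P), 1, w; split=> //; first exact: Dmul.
- exact: oner_neq0.
- by rewrite scale1r.
- by rewrite mxE subnn mulr1 polyC_eq0.
apply: row_size_ltP => // k; rewrite -[ltnRHS]prednK // ltnS.
apply/leq_sizeP => t jt; rewrite mxE coef_sum.
transitivity ((u *m lead_row_mx P) 0 k *+ (t == (row_size P j).-1)); last first.
  by rewrite uP mxE mul0rn.
rewrite mxE -sumrMnl; apply: eq_bigr => i _; rewrite !mxE.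
have [->|ui] := eqVneq (u 0 i) 0; first by rewrite !mul0r coef0 mul0rn.
have ij := umax _ ui; rewrite -mulrA coefCM coefXnM.
have jit : (row_size P j - row_size P i <= t)%N.
  apply: leq_trans jt; rewrite -subn1 leq_sub2l //.
rewrite ltnNge jit /=; have [->|tj] := eqVneq t (row_size P j).-1.
  rewrite mulr1n -subn1 subnAC subKn // subn1 //.
rewrite mulr0n nth_default ?mulr0 //; apply: leq_trans (size_row_size _ _ _) _.
rewrite leq_subRL // subnK //.
by rewrite -[row_size P j]prednK // ltn_neqAle eq_sym tj.
Qed.

Let sort_rows (P : 'M[{poly C}]_(d, m)) : exists s : 'S_d,
  forall i j : 'I_d, (i <= j)%N -> (row_size P (s j) <= row_size P (s i))%N.
Proof.
pose leP (i j : 'I_d) := (row_size P j <= row_size P i)%N.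
have leP_total : total leP by move=> i j; apply: leq_total.
have leP_trans : transitive leP by move=> i j k ij jk; apply: leq_trans jk ij.
have [s sE] := tuple_permP (t := ord_tuple d) (permEl (perm_sort leP (enum 'I_d))).
exists s => i j ij; pose t := sort leP (enum 'I_d).
have tE (k : 'I_d) : nth i t k = s k.
  have szt : size t = d by rewrite size_sort size_enum_ord.
  have kd : (k < size (enum 'I_d))%N by rewrite size_enum_ord.
  by rewrite /t sE (nth_map k) // nth_ord_enum tnth_ord_tuple.
have := sorted_leq_nth leP_trans (fun k => leqnn _) i (sort_sorted leP_total (enum 'I_d)).
move=> /(_ i j); rewrite !inE size_sort size_enum_ord -/t !tE; exact.
Qed.

Lemma minimal_basis (P0 : 'M[{poly C}]_(d, m)) :
    (forall i, D (row i P0)) -> poly_free P0 ->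
  exists P : 'M_(d, m), [/\ forall i, D (row i P),
    forall z, \rank (mxeval P z) = d, \rank (lead_row_mx P) = d,
    forall i j : 'I_d, (i <= j)%N -> (row_size P j <= row_size P i)%N &
    forall i, (0 < row_size P i)%N].
Proof.
have [s] := ubnP (\sum_i row_size P0 i)%N.
elim: s P0 => // s IHs P /ltnSE Ps DP Pfree.
have [[Prk Plead]|bad] := pselect
    ((forall z, \rank (mxeval P z) = d) /\ \rank (lead_row_mx P) = d); last first.
  have [j [r [a [w [Dr a0 ar wj rP]]]]] := descend DP Pfree bad.
  apply: (IHs (replace_row P j r)).
  - exact: leq_trans (row_size_replace rP) Ps.
  - move=> i; rewrite rowK; case: eqP => // _; exact: DP.
  - exact: poly_free_replace Pfree a0 ar wj.
have [t tP] := sort_rows P; have permP k (A : 'M[C]_(d, k)) :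
    \rank (row_perm t A) = \rank A.
  by rewrite row_permE eqmxMfull // row_full_unit unitmx_perm.
exists (row_perm t P); have rsE i : row_size (row_perm t P) i = row_size P (t i).
  by apply: eq_bigr => k _; rewrite mxE.
split.
- move=> i; have -> : row i (row_perm t P) = row (t i) P; last exact: DP.
  by apply/rowP => k; rewrite !mxE.
- by move=> z; rewrite /mxeval map_row_perm permP Prk.
- rewrite -[RHS]Plead -(permP _ (lead_row_mx P)); congr (\rank _).
  by apply/matrixP => i k; rewrite !mxE rsE.
- by move=> i j ij; rewrite !rsE tP.
- by move=> i; rewrite rsE poly_free_row_size_gt0.
Qed.

End MinimalBasis.
End PolynomialMatrices.

(** * Lagrangian models of the extensions *)

Section Ctrans.
Context {R : realType}.
Local Notation C := R[i].

Lemma ctransK m n (A : 'M[C]_(m, n)) : ctrans (ctrans A) = A.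
Proof. by apply/matrixP => i j; rewrite !mxE conjCK. Qed.

Lemma ctransM m n p (A : 'M[C]_(m, n)) (B : 'M_(n, p)) :
  ctrans (A *m B) = ctrans B *m ctrans A.
Proof. by rewrite /ctrans trmx_mul map_mxM. Qed.

Lemma ctransD m n (A B : 'M[C]_(m, n)) : ctrans (A + B) = ctrans A + ctrans B.
Proof. by rewrite /ctrans linearD map_mxD. Qed.

Lemma ctransN m n (A : 'M[C]_(m, n)) : ctrans (- A) = - ctrans A.
Proof. by rewrite /ctrans linearN map_mxN. Qed.

Lemma ctransB m n (A B : 'M[C]_(m, n)) : ctrans (A - B) = ctrans A - ctrans B.
Proof. by rewrite ctransD ctransN. Qed.

Lemma ctransZ m n a (A : 'M[C]_(m, n)) :
  ctrans (a *: A) = Num.conj a *: ctrans A.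
Proof. by rewrite /ctrans linearZ map_mxZ. Qed.

Lemma ctrans0 m n : ctrans (0 : 'M[C]_(m, n)) = 0.
Proof. by rewrite /ctrans trmx0 map_mx0. Qed.

Lemma ctrans1 n : ctrans (1%:M : 'M[C]_n) = 1%:M.
Proof. by rewrite /ctrans trmx1 map_mx1. Qed.

Lemma ctrans_sum m n (I : Type) (r : seq I) (P : pred I) (A : I -> 'M[C]_(m, n)) :
  ctrans (\sum_(i <- r | P i) A i) = \sum_(i <- r | P i) ctrans (A i).
Proof.
by apply: (big_morph _ (@ctransD _ _)); apply: ctrans0.
Qed.

Lemma ctrans_inj m n : injective (@ctrans R m n).
Proof. exact: can_inj (@ctransK m n). Qed.

Lemma ctrans_eq0 m n (A : 'M[C]_(m, n)) : ctrans A = 0 -> A = 0.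
Proof. by move=> A0; apply: ctrans_inj; rewrite A0 ctrans0. Qed.

Lemma rank_ctrans m n (A : 'M[C]_(m, n)) : \rank (ctrans A) = \rank A.
Proof. by rewrite /ctrans mxrank_map mxrank_tr. Qed.

Lemma ctrans_trC m n (A : 'M[C]_(m, n)) : (ctrans A)^T = ctrans A^T.
Proof. by apply/matrixP => i j; rewrite !mxE. Qed.

Lemma unitmx_ctrans n (A : 'M[C]_n) : (ctrans A \in unitmx) = (A \in unitmx).
Proof. by rewrite /ctrans map_unitmx unitmx_tr. Qed.

End Ctrans.

Lemma row_fullP_col (F : fieldType) m n (A : 'M[F]_(m, n)) :
  (forall y : 'cV_n, A *m y = 0 -> y = 0) -> row_full A.
Proof.
move=> Ainj; rewrite /row_full -mxrank_tr; apply: contraT => /eqP/eqP.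
move=> /rank_lt_ker[u /negP u0 uA]; case: u0; apply/eqP/trmx_inj.
by rewrite trmx0; apply: Ainj; apply: trmx_inj; rewrite trmx_mul trmxK uA trmx0.
Qed.

Lemma row_freeP_row (F : fieldType) m n (A : 'M[F]_(m, n)) :
  (forall y : 'rV_m, y *m A = 0 -> y = 0) -> row_free A.
Proof.
move=> Ainj; apply: contraT; rewrite /row_free => /rank_lt_ker[u /negP u0 uA].
by case: u0; apply/eqP/Ainj.
Qed.

Lemma row_full_mul_eq0 (F : fieldType) m n p (A : 'M[F]_(m, n)) (Y : 'M_(n, p)) :
  row_full A -> A *m Y = 0 -> Y = 0.
Proof.
by move=> Af AY; rewrite -[Y]mul1mx -(mulVpmx Af) -mulmxA AY mulmx0.
Qed.

(* Upper half plane points: no two of them are conjugate. *)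
Definition node {R : realType} (k : nat) : R[i] := 'i * k.+1%:R.

Lemma node_inj (R : realType) : injective (@node R).
Proof.
move=> j k /(mulfI (neq0Ci _))/eqP; rewrite eqr_nat => /eqP[].
by [].
Qed.

Lemma conj_node_neq (R : realType) j k : @node R j - Num.conj (node k) != 0.
Proof.
rewrite /node rmorphM /= conjCi conjC_nat mulNr opprK -mulrDr -natrD.
by rewrite mulf_neq0 ?neq0Ci // pnatr_eq0.
Qed.

Section Models.
Context {R : realType}.
Local Notation C := R[i].
Variables (d : nat) (Q : 'M[C]_(2 * d)).

(* The rows of [Cc E F] span the Lagrangian subspace of the triples (b h, x, y)
   for which the pair {h1 + x, h2 + y}, h = {h1, h2}, belongs to the extension; x
   and y are coordinates in the finite-dimensional orthogonal complement of the
   small Krein space, whose Gram matrix is G. *)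
Record lagrangian_model n (G : 'M[C]_n) (Cc : 'M[C]_(d + n, 2 * d))
    (E F : 'M[C]_(d + n, n)) : Prop := LagrangianModel {
  model_unit : G \in unitmx;
  model_herm : ctrans G = G;
  model_neutral : Cc *m Q^T *m ctrans Cc
      + 'i *: (E *m G *m ctrans F - F *m G *m ctrans E) = 0;
  model_op : forall v : 'rV_(d + n), v *m Cc = 0 -> v *m E = 0 -> v = 0;
  model_eig : forall z (v : 'rV_(d + n)), v *m Cc = 0 ->
      v *m F = z *: (v *m E) -> v = 0 }.

Hypothesis Qunit : Q \in unitmx.

(** The Lagrangian form with its second argument fixed to the rows of (Cc, E, F): a row (c, x, y) is
    orthogonal to all of them exactly when this matrix kills it. *)
Definition dual_mx n (G : 'M[C]_n) r (Cc : 'M[C]_(r, 2 * d)) (E F : 'M[C]_(r, n)) :=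
  col_mx (Q^T *m ctrans Cc)
    (col_mx ('i *: (G *m ctrans F)) (- ('i *: (G *m ctrans E)))).

Lemma mul_dual_mx n (G : 'M[C]_n) r (Cc : 'M[C]_(r, 2 * d)) (E F : 'M[C]_(r, n))
    k (c : 'M[C]_(k, 2 * d)) (x y : 'M_(k, n)) :
  row_mx c (row_mx x y) *m dual_mx G Cc E F =
    c *m Q^T *m ctrans Cc + 'i *: (x *m G *m ctrans F - y *m G *m ctrans E).
Proof. by rewrite !mul_row_col mulmxN -!scalemxAr !mulmxA scalerBr. Qed.

Lemma rank_dual_mx n (G : 'M[C]_n) r (Cc : 'M[C]_(r, 2 * d)) (E F : 'M[C]_(r, n)) :
  G \in unitmx -> row_free (row_mx Cc (row_mx E F)) -> \rank (dual_mx G Cc E F) = r.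
Proof.
move=> Gunit Bfree; apply/eqP; rewrite -/(row_full _); apply: row_fullP_col => t.
rewrite !mul_col_mx => /eqP; rewrite !col_mx_eq0 => /and3P[/eqP Ct /eqP Ft /eqP Et].
have cancelG (A : 'M[C]_(r, n)) : 'i *: (G *m ctrans A) *m t = 0 -> ctrans t *m A = 0.
  move=> /eqP; rewrite -scalemxAl scaler_eq0 (negPf (neq0Ci _)) /= -mulmxA => /eqP At.
  apply: ctrans_eq0; rewrite ctransM ctransK; apply: (row_full_mul_eq0 (A := G)) => //.
  by rewrite row_full_unit.
have tC : ctrans t *m Cc = 0.
  apply: ctrans_eq0; rewrite ctransM ctransK; apply: (row_full_mul_eq0 (A := Q^T)).
    by rewrite row_full_unit unitmx_tr.
  by rewrite mulmxA.
move/eqP: Et; rewrite mulNmx oppr_eq0 => /eqP Et.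
apply: ctrans_eq0; apply: (row_free_mul_eq0 Bfree).
by rewrite !mul_mx_row tC !cancelG // !row_mx0.
Qed.

Section OneModel.
Variables (n : nat) (G : 'M[C]_n) (Cc : 'M[C]_(d + n, 2 * d)).
Variables (E F : 'M[C]_(d + n, n)).
Hypothesis M : lagrangian_model G Cc E F.

(** Self-adjointness in coordinates: a neutral subspace of dimension d+n in a nondegenerate space of
    dimension 2d+2n is its whole annihilator. *)
Lemma model_maximal k (c : 'M[C]_(k, 2 * d)) (x y : 'M_(k, n)) :
    c *m Q^T *m ctrans Cc + 'i *: (x *m G *m ctrans F - y *m G *m ctrans E) = 0 ->
  exists v, [/\ c = v *m Cc, x = v *m E & y = v *m F].
Proof.
move=> cxy0; pose B := row_mx Cc (row_mx E F).
have Bfree : row_free B.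
  apply: row_freeP_row => v; rewrite !mul_mx_row -row_mx0 => /eq_row_mx[vC].
  by rewrite -row_mx0 => /eq_row_mx[vE _]; apply: model_op M _ _ _.
pose N := dual_mx G Cc E F.
have BN : (B <= kermx N)%MS by apply/sub_kermxP; rewrite mul_dual_mx (model_neutral M).
have : (row_mx c (row_mx x y) <= B)%MS.
  apply: (@submx_trans _ _ _ _ _ _ (kermx N)); first by apply/sub_kermxP; rewrite mul_dual_mx.
  suff /andP[] : (B == kermx N)%MS by [].
  have [_ <-] := mxrank_leqif_eq BN.
  by rewrite (eqP Bfree) mxrank_ker rank_dual_mx ?(model_unit M) //; apply/eqP; lia.
move=> /submxP[v]; rewrite !mul_mx_row => /eq_row_mx[-> /eq_row_mx[-> ->]].
by exists v.
Qed.

(** A column killed by E yields, by maximality, a triple (0, 0, y) in the model, which [model_op]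
    excludes. *)
Lemma model_row_full_E : row_full E.
Proof.
apply: row_fullP_col => y Ey; apply: ctrans_eq0.
have [|v [vC vE vF]] := @model_maximal _ 0 0 (ctrans y *m invmx G).
  by rewrite !mul0mx mulmxKV ?(model_unit M) // -ctransM Ey ctrans0 subrr scaler0 addr0.
by rewrite -(mulmxKV (model_unit M) (ctrans y)) vF (model_op M (esym vC) (esym vE)) !mul0mx.
Qed.

(** As for E, but a column killed at z produces an eigenvector at the conjugate of z, because the
    form is sesquilinear. *)
Lemma model_row_full z : row_full (F - z *: E).
Proof.
apply: row_fullP_col => y Ey; apply: ctrans_eq0; pose x := ctrans y *m invmx G.
have [|v [vC vE vF]] := @model_maximal _ 0 x (Num.conj z *: x).
  rewrite !mul0mx add0r -!scalemxAl mulmxKV ?(model_unit M) // -!ctransM.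
  by rewrite -ctransZ -ctransB scalemxAl -mulmxBl Ey ctrans0 scaler0.
have v0 : v = 0 by apply: (model_eig M (esym vC) (z := Num.conj z)); rewrite -vE -vF.
have x0 : x = 0 by rewrite vE v0 mul0mx.
by rewrite -(mulmxKV (model_unit M) (ctrans y)) -/x x0 mul0mx.
Qed.

Definition pencil_ker z := kermx (F - z *: E).

Lemma pencil_kerP z k (v : 'M[C]_(k, d + n)) :
  reflect (v *m F = z *: (v *m E)) (v <= pencil_ker z)%MS.
Proof.
apply: (iffP sub_kermxP); rewrite mulmxBr scalemxAr; first by move/eqP; rewrite subr_eq0 => /eqP.
by move=> ->; rewrite subrr.
Qed.

(* The Shtraus subspace at z in terms of boundary values. *)
Definition shtraus z := pencil_ker z *m Cc.

Lemma shtrausP z k (c : 'M[C]_(k, 2 * d)) :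
  (c <= shtraus z)%MS <-> exists v, c = v *m Cc /\ v *m F = z *: (v *m E).
Proof.
split.
  move=> /submxP[w ->]; exists (w *m pencil_ker z); rewrite mulmxA; split=> //.
  by apply/pencil_kerP; rewrite submxMl.
by move=> [v [-> /pencil_kerP vk]]; rewrite submxMr.
Qed.

(** The kernel of a full pencil with d+n rows and n columns has dimension d, and [model_eig] makes
    [Cc] injective on it. *)
Lemma rank_shtraus z : \rank (shtraus z) = d.
Proof.
have rk : \rank (pencil_ker z) = d.
  by rewrite mxrank_ker (eqP (model_row_full z)) addnK.
have := mxrank_mul_ker (pencil_ker z) Cc; rewrite rk => rkd; rewrite /shtraus.
suff z0 : \rank (pencil_ker z :&: kermx Cc)%MS = 0%N by apply: etrans rkd; rewrite z0 addn0.
apply/eqP; rewrite mxrank_eq0; apply/eqP/row_matrixP => i; rewrite row0.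
have := row_sub i (pencil_ker z :&: kermx Cc)%MS.
rewrite sub_capmx => /andP[/pencil_kerP vF /sub_kermxP vC].
exact: (model_eig M vC vF).
Qed.

(** Lagrange's identity. For a different from the conjugate of b it recovers inner products from
    boundary values; for a equal to it, it gives neutrality. *)
Lemma model_green k l (v : 'M[C]_(k, d + n)) (w : 'M[C]_(l, d + n)) a b :
    v *m F = a *: (v *m E) -> w *m F = b *: (w *m E) ->
  v *m Cc *m Q^T *m ctrans (w *m Cc) =
    ('i * (a - Num.conj b)) *: (v *m E *m G *m ctrans (w *m E)).
Proof.
move=> vF wF.
have : v *m (Cc *m Q^T *m ctrans Cc + 'i *: (E *m G *m ctrans F - F *m G *m ctrans E))
    *m ctrans w = 0 by rewrite (model_neutral M) mulmx0 mul0mx.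
rewrite mulmxDr mulmxDl -scalemxAr -scalemxAl mulmxBr mulmxBl !mulmxA vF.
rewrite -(mulmxA _ (ctrans F)) -ctransM wF ctransZ !ctransM => /eqP.
rewrite addr_eq0 !mulmxA => /eqP->.
rewrite -!scalemxAl -!scalemxAr !mulmxA -scalerBl scalerA -scaleNr.
by rewrite -mulrN opprB.
Qed.

Lemma shtraus_neutral z k l (c : 'M[C]_(k, 2 * d)) (c' : 'M[C]_(l, 2 * d)) :
  (c <= shtraus z)%MS -> (c' <= shtraus (Num.conj z))%MS ->
  c *m Q^T *m ctrans c' = 0.
Proof.
move=> /shtrausP[v [-> vF]] /shtrausP[w [-> wF]].
by rewrite (model_green vF wF) conjCK subrr mulr0 scale0r.
Qed.

Lemma model_span : exists K (V : 'I_K -> 'M[C]_(d + n)),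
  1%:M = \sum_k V k /\ forall k, V k *m F = node k *: (V k *m E).
Proof.
have [K] := pencil_kernels_span (@node_inj R) model_row_full_E model_row_full.
move=> /sub_sumsmxP[u uE].
exists K, (fun k => u k *m pencil_ker (node k)); split=> // k.
by apply/pencil_kerP; rewrite submxMl.
Qed.

End OneModel.
End Models.

(** * Uniqueness of the model with given Shtraus subspaces *)

Section TwoModels.
Context {R : realType}.
Local Notation C := R[i].
Variables (d : nat) (Q : 'M[C]_(2 * d)).
Hypothesis Qunit : Q \in unitmx.

Let models_partner n1 (G1 : 'M[C]_n1) (C1 : 'M[C]_(d + n1, 2 * d)) (E1 F1 : 'M_(d + n1, n1))
    n2 (G2 : 'M[C]_n2) (C2 : 'M[C]_(d + n2, 2 * d)) (E2 F2 : 'M_(d + n2, n2)) :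
    lagrangian_model Q G1 C1 E1 F1 -> lagrangian_model Q G2 C2 E2 F2 ->
    (forall z, (shtraus C1 E1 F1 z <= shtraus C2 E2 F2 z)%MS) ->
  exists K (V : 'I_K -> 'M[C]_(d + n1)) (W : 'I_K -> 'M[C]_(d + n1, d + n2)),
    [/\ 1%:M = \sum_k V k,
     forall k, V k *m F1 = node k *: (V k *m E1),
     forall k, W k *m F2 = node k *: (W k *m E2),
     forall k, V k *m C1 = W k *m C2 &
     forall j k, V j *m E1 *m G1 *m ctrans (V k *m E1)
               = W j *m E2 *m G2 *m ctrans (W k *m E2)].
Proof.
move=> M1 M2 sub12; have [K [V [V1 VF]]] := model_span Qunit M1.
have /choice[W WP] : forall k, exists W : 'M[C]_(d + n1, d + n2),
    V k *m C1 = W *m C2 /\ W *m F2 = node k *: (W *m E2).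
  by move=> k; apply/shtrausP/(submx_trans _ (sub12 _))/shtrausP; exists (V k).
exists K, V, W; split=> // [k|k|j k]; try by case: (WP k).
have [CWj Wj] := WP j; have [CWk Wk] := WP k.
apply: (scalerI (mulf_neq0 (neq0Ci _) (@conj_node_neq R j k))).
by rewrite -(model_green M1 (VF j) (VF k)) -(model_green M2 Wj Wk) CWj CWk.
Qed.

Let models_compare n1 (G1 : 'M[C]_n1) (C1 : 'M[C]_(d + n1, 2 * d)) (E1 F1 : 'M_(d + n1, n1))
    n2 (G2 : 'M[C]_n2) (C2 : 'M[C]_(d + n2, 2 * d)) (E2 F2 : 'M_(d + n2, n2)) :
    lagrangian_model Q G1 C1 E1 F1 -> lagrangian_model Q G2 C2 E2 F2 ->
    (forall z, (shtraus C1 E1 F1 z <= shtraus C2 E2 F2 z)%MS) ->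
  (n1 <= n2)%N /\ ((n2 <= n1)%N ->
  exists (Theta : 'M[C]_(d + n1, d + n2)) (U : 'M[C]_(n1, n2)),
    [/\ U *m G2 *m ctrans U = G1, C1 = Theta *m C2,
        E1 *m U = Theta *m E2 & F1 *m U = Theta *m F2]).
Proof.
(* Elements of the kernels at two nodes have an inner product determined by
   their boundary values, so matching boundary values matches Gram matrices;
   the kernels span everything. *)
move=> M1 M2 sub12.
have [K [V [W [V1 VF WF VW VWip]]]] := models_partner M1 M2 sub12.
have E1full := model_row_full_E Qunit M1.
have G1u := model_unit M1; have G2u := model_unit M2.
(* Since the [V k] sum to the identity, the sum of their partners [W k] sends every coordinate
   vector of the first model to its counterpart; [X] will turn out to be [E1 U]. *)
pose Theta := \sum_k W k; have [X XE] : exists X, X = Theta *m E2 by eexists.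
have VX j : V j *m E1 *m G1 *m ctrans E1 = W j *m E2 *m G2 *m ctrans X.
  rewrite XE /Theta mulmx_suml ctrans_sum mulmx_sumr.
  rewrite -[E1 in ctrans E1]mul1mx V1 mulmx_suml ctrans_sum mulmx_sumr.
  by apply: eq_bigr => k _; rewrite VWip.
have XX : X *m G2 *m ctrans X = E1 *m G1 *m ctrans E1.
  rewrite -[E1 in E1 *m G1]mul1mx V1 {1}XE {1}/Theta !mulmx_suml.
  by apply: eq_bigr => j _; rewrite VX.
have n1X : (n1 <= \rank X)%N.
  have rk : \rank (E1 *m G1 *m ctrans E1) = n1.
    rewrite mxrankMfree ?(eqP E1full) //.
      by rewrite mxrankMfree ?(eqP E1full) // row_free_unit.
    by rewrite /row_free rank_ctrans.
  by rewrite -[leqLHS]rk -XX -mulmxA mxrankM_maxl.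
split; first exact: leq_trans n1X (rank_leq_col X).
move=> n21; have Xfull : row_full X.
  by rewrite /row_full eqn_leq rank_leq_col (leq_trans n21).
have Xcancel k (A B : 'M[C]_(k, n2)) :
    A *m G2 *m ctrans X = B *m G2 *m ctrans X -> A = B.
  move=> AB; apply: (row_free_inj (A := G2 *m ctrans X)); last by rewrite !mulmxA.
  by rewrite /row_free eqmxMfull ?row_full_unit // rank_ctrans.
have [E1' E1K] : exists E1', E1' *m E1 = 1%:M.
  by exists (pinvmx E1); rewrite mulVpmx.
have [U UE] : exists U, U = E1' *m X by eexists.
have E1U : E1 *m U = X.
  apply: Xcancel; rewrite UE -!mulmxA (mulmxA X) XX -mulmxA.
  by rewrite (mulmxA E1') E1K mul1mx.
have VU j : V j *m E1 *m U = W j *m E2.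
  by apply: Xcancel; rewrite -VX -(mulmxA (V j)) E1U -!mulmxA (mulmxA X) XX -!mulmxA.
exists Theta, U; split=> //.
- apply: (row_free_inj (A := ctrans E1)); first by rewrite /row_free rank_ctrans.
  apply: (row_full_inj E1full) => /=.
  by rewrite !mulmxA -XX -E1U ctransM !mulmxA.
- by rewrite -[C1]mul1mx V1 /Theta !mulmx_suml; apply: eq_bigr => k _.
- by rewrite -XE.
- rewrite -[F1]mul1mx V1 /Theta !mulmx_suml; apply: eq_bigr => k _.
  by rewrite VF WF -scalemxAl VU.
Qed.

Lemma models_isometry n1 (G1 : 'M[C]_n1) (C1 : 'M[C]_(d + n1, 2 * d)) (E1 F1 : 'M_(d + n1, n1))
    n2 (G2 : 'M[C]_n2) (C2 : 'M[C]_(d + n2, 2 * d)) (E2 F2 : 'M_(d + n2, n2)) :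
    lagrangian_model Q G1 C1 E1 F1 -> lagrangian_model Q G2 C2 E2 F2 ->
    (forall z, (shtraus C1 E1 F1 z == shtraus C2 E2 F2 z)%MS) ->
  exists (Theta : 'M[C]_(d + n1, d + n2)) (U : 'M[C]_(n1, n2)),
    [/\ row_full Theta, row_free U, row_full U, U *m G2 *m ctrans U = G1 &
    [/\ C1 = Theta *m C2, E1 *m U = Theta *m E2 & F1 *m U = Theta *m F2]].
Proof.
move=> M1 M2 eq12.
have sub12 z : (shtraus C1 E1 F1 z <= shtraus C2 E2 F2 z)%MS by case/andP: (eq12 z).
have sub21 z : (shtraus C2 E2 F2 z <= shtraus C1 E1 F1 z)%MS by case/andP: (eq12 z).
have [n12 iso] := models_compare M1 M2 sub12; have [n21 _] := models_compare M2 M1 sub21.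
have [Theta [U [UG TC TE TF]]] := iso n21; have n1n2 : n1 = n2 by lia.
have Ufree : row_free U.
  apply: row_freeP_row => v vU; apply: (row_free_mul_eq0 (A := G1)).
    by rewrite row_free_unit (model_unit M1).
  by rewrite -UG !mulmxA vU !mul0mx.
have Tfree : row_free Theta.
  apply: row_freeP_row => v vT; apply: (model_op M1).
    by rewrite TC mulmxA vT mul0mx.
  by apply: (row_free_mul_eq0 Ufree); rewrite -mulmxA TE mulmxA vT mul0mx.
exists Theta, U; split=> //.
  by rewrite /row_full (eqP Tfree) n1n2.
by rewrite /row_full (eqP Ufree) n1n2.
Qed.

End TwoModels.

(** * From models to polynomials *)

Lemma rank_geP (F : fieldType) m n d (M : 'M[F]_(m, n)) : (d <= \rank M)%N ->
  exists (A : 'M_(d, m)) (B : 'M_(n, d)), A *m M *m B = 1%:M.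
Proof.
move=> dr; exists (pid_mx d *m invmx (col_ebase M)), (invmx (row_ebase M) *m pid_mx d).
transitivity (pid_mx d *m invmx (col_ebase M) *m
   (col_ebase M *m pid_mx (\rank M) *m row_ebase M) *m (invmx (row_ebase M) *m pid_mx d) : 'M_d).
  by rewrite mulmx_ebase.
rewrite !mulmxA mulmxKV ?col_ebase_unit // mulmxK ?row_ebase_unit //.
rewrite !mul_pid_mx -pid_mx_1; congr (pid_mx _).
have := rank_leq_row M; have := rank_leq_col M; lia.
Qed.

Section ModelToPolynomial.
Context {R : realType}.
Local Notation C := R[i].
Local Notation "A ^:C" := (map_mx polyC A) (at level 2, left associativity, format "A ^:C").
Variables (d : nat) (Q : 'M[C]_(2 * d)).
Hypothesis Qunit : Q \in unitmx.

Lemma polymx_free_unit k (w : 'rV[{poly C}]_k) (M : 'M[{poly C}]_k) z :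
  mxeval M z = 1%:M -> w *m M = 0 -> w = 0.
Proof.
move=> Mz wM; have : w *m M *m \adj M = 0 by rewrite wM mul0mx.
rewrite -mulmxA mul_mx_adj mul_mx_scalar -[RHS](scaler0 _ (\det M)).
apply: scalepoly_inj; apply: contra_eq_neq (mxeval_det M z) => ->.
by rewrite horner0 Mz det1 eq_sym oner_eq0.
Qed.

Variables (n : nat) (G : 'M[C]_n) (Cc : 'M[C]_(d + n, 2 * d)).
Variables (E F : 'M[C]_(d + n, n)).
Hypothesis M : lagrangian_model Q G Cc E F.

Let pencil : 'M[{poly C}]_(d + n, n) := F^:C - 'X *: E^:C.

Let pencil_eval z : mxeval pencil z = F - z *: E.
Proof. by rewrite mxevalB mxevalZ hornerX !mxevalC. Qed.

(* Such a p vanishes on [shtraus z] at every z, q certifying this polynomially;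
   the certificate makes the module of these p saturated. *)
Let annihilates (p : 'rV[{poly C}]_(2 * d)) :=
  exists q : 'rV_n, p *m Cc^T^:C + q *m pencil^T = 0.

Let pencil_cancel k (q : 'M[{poly C}]_(k, n)) z :
  mxeval q z *m (mxeval pencil z)^T = 0 -> mxeval q z = 0.
Proof.
apply: row_free_mul_eq0; rewrite /row_free mxrank_tr pencil_eval.
by rewrite (eqP (model_row_full Qunit M z)).
Qed.

Let annihilates0 : annihilates 0.
Proof. by exists 0; rewrite !mul0mx addr0. Qed.

Let annihilates_lin a p q : annihilates p -> annihilates q -> annihilates (a *: p + q).
Proof.
move=> [p' pE] [q' qE]; exists (a *: p' + q').
by rewrite !mulmxDl -!scalemxAl addrACA -scalerDr pE qE scaler0 addr0.
Qed.

Let annihilates_sat z p : annihilates (('X - z%:P) *: p) -> annihilates p.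
Proof.
move=> [q pq]; have : mxeval q z *m (mxeval pencil z)^T = 0.
  have := congr1 (fun A => mxeval A z) pq.
  rewrite mxevalD !mxevalM mxevalZ !hornerE subrr scale0r mul0mx add0r mxeval0.
  by rewrite mxeval_tr.
move=> /pencil_cancel/mxeval_eq0_factor[r rE]; exists r.
apply: (@scalepoly_inj _ _ _ ('X - z%:P)); first by rewrite polyXsubC_eq0.
by rewrite scaler0 scalerDr !scalemxAl -rE.
Qed.

Let annihilates_free : exists P : 'M[{poly C}]_(d, 2 * d),
  (forall i, annihilates (row i P)) /\ poly_free P.
Proof.
(* The pairs (p, q) sought are left annihilators of [D], which has d more rows than columns. A left
   inverse at z = 0 exists because 0 is not an eigenvalue. *)
pose D := col_mx Cc^T^:C pencil^T.
have D0 : mxeval D 0 = col_mx Cc^T F^T.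
  rewrite /mxeval map_col_mx -!/(mxeval _ _) mxevalC mxeval_tr pencil_eval.
  by rewrite scale0r subr0.
have [K KD] : exists K, K *m mxeval D 0 = 1%:M.
  exists (pinvmx (mxeval D 0)); apply: mulVpmx; apply: row_fullP_col => y.
  rewrite D0 mul_col_mx => /eqP; rewrite col_mx_eq0 => /andP[/eqP Cy /eqP Fy].
  apply: trmx_inj; rewrite trmx0; apply: (model_eig M (z := 0)).
    by apply: trmx_inj; rewrite trmx_mul trmxK Cy trmx0.
  by rewrite scale0r; apply: trmx_inj; rewrite trmx_mul trmxK Fy trmx0.
pose W := K^:C *m D.
have W0 : mxeval W 0 = 1%:M by rewrite mxevalM mxevalC KD.
(* N0 annihilates D, and at 0 it is the projection along the range of D. *)
pose N0 := (\det W)%:M - D *m \adj W *m K^:C.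
have N0D : N0 *m D = 0.
  rewrite mulmxBl mul_scalar_mx -!mulmxA -/W mul_adj_mx mul_mx_scalar.
  by rewrite subrr.
have N00 : mxeval N0 0 = 1%:M - mxeval D 0 *m K.
  have adj0 : mxeval (\adj W) 0 = 1%:M.
    have := congr1 (fun A => mxeval A 0) (mul_mx_adj W).
    rewrite mxevalM W0 mul1mx => ->.
    by rewrite mxeval_scalar mxeval_det W0 det1.
  rewrite mxevalB !mxevalM adj0 mulmx1 mxevalC mxeval_scalar.
  by rewrite mxeval_det W0 det1.
(* The projection at 0 has rank at least d, so [A] selects d combinations of annihilators
   independent at 0, and independence at one point gives freeness over the polynomials. *)
have [A [B AB]] : exists (A : 'M_(d, _)) (B : 'M_(_, d)), A *m mxeval N0 0 *m B = 1%:M.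
  apply: rank_geP; have := mxrank_add (mxeval N0 0) (mxeval D 0 *m K).
  rewrite N00 subrK mxrank1; have := mxrankM_maxl (mxeval D 0) K.
  have := rank_leq_col (mxeval D 0).
  move=> rD rDK r1; rewrite -(leq_add2r (d + n)) addnA addnn -mul2n.
  by apply: leq_trans r1 _; rewrite leq_add2l (leq_trans rDK).
pose N := A^:C *m N0.
have ND : lsubmx N *m Cc^T^:C + rsubmx N *m pencil^T = 0.
  by rewrite -mul_row_col hsubmxK -mulmxA N0D mulmx0.
exists (lsubmx N); split=> [i|w wN].
  by exists (row i (rsubmx N)); rewrite -!row_mul -[_ + _]linearD /= ND row0.
(* The certificate q is determined by p, because the pencil is onto at every point; thus freeness of
   the pairs passes to their first halves. *)
have q0 : w *m rsubmx N = 0.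
  apply: mxeval_inj => z; rewrite mxeval0; apply: pencil_cancel.
  rewrite -mxeval_tr -mxevalM -mulmxA.
  have -> : w *m (rsubmx N *m pencil^T) = w *m (lsubmx N *m Cc^T^:C + rsubmx N *m pencil^T).
    by rewrite mulmxDr [w *m (lsubmx _ *m _)]mulmxA wN mul0mx add0r.
  rewrite ND mulmx0.
  exact: mxeval0.
apply: (@polymx_free_unit _ _ (N *m B^:C) 0).
  by rewrite !mxevalM !mxevalC.
by rewrite mulmxA -[N]hsubmxK mul_mx_row wN q0 row_mx0 mul0mx.
Qed.

(** The subspaces at z and at its conjugate annihilate each other, and both have dimension d in a
    space of dimension 2d. *)
Lemma shtraus_maximal z k (c : 'M[C]_(k, 2 * d)) :
  shtraus Cc E F z *m Q^T *m ctrans c = 0 -> (c <= shtraus Cc E F (Num.conj z))%MS.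
Proof.
set S := shtraus Cc E F z => Sc; pose B := ctrans (S *m Q^T).
have : (shtraus Cc E F (Num.conj z) <= kermx B)%MS.
  apply/sub_kermxP; apply: ctrans_eq0; rewrite ctransM ctransK.
  exact: (shtraus_neutral M (submx_refl _) (submx_refl _)).
move=> SB; apply: (@submx_trans _ _ _ _ _ _ (kermx B)).
  by apply/sub_kermxP; apply: ctrans_eq0; rewrite ctransM ctransK.
suff /andP[] : (shtraus Cc E F (Num.conj z) == kermx B)%MS by [].
have [_ <-] := mxrank_leqif_eq SB; rewrite (rank_shtraus Qunit M) mxrank_ker.
have -> : \rank B = d; last by apply/eqP; lia.
rewrite rank_ctrans mxrankMfree ?(rank_shtraus Qunit M) //.
by rewrite row_free_unit unitmx_tr.
Qed.

Lemma model_polynomial : exists P : 'M[{poly C}]_(d, 2 * d),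
  PQ Q P /\ forall z, (shtraus Cc E F z == kermx (mxeval P z)^T)%MS.
Proof.
have [P0 [P0ann P0free]] := annihilates_free.
have [P [Pann Prk Plead Psort Ppos]] :=
  minimal_basis annihilates0 annihilates_lin annihilates_sat P0ann P0free.
have PS z : (shtraus Cc E F z == kermx (mxeval P z)^T)%MS.
  have SP : (shtraus Cc E F z <= kermx (mxeval P z)^T)%MS.
    apply/sub_kermxP; apply: trmx_inj; rewrite trmx_mul trmxK trmx0.
    apply/row_matrixP => i; rewrite row_mul row0; have [q pq] := Pann i.
    have := congr1 (fun A => mxeval A z) pq; rewrite mxevalD !mxevalM mxevalC.
    rewrite mxeval0 mxeval_tr pencil_eval => /eqP; rewrite addr_eq0 => /eqP pE.
    have -> : row i (mxeval P z) = mxeval (row i P) z by apply/rowP => k; rewrite !mxE.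
    rewrite trmx_mul mulmxA pE mulNmx -mulmxA -trmx_mul mulmx_ker.
    by rewrite trmx0 mulmx0 oppr0.
  have [_ <-] := mxrank_leqif_eq SP; rewrite (rank_shtraus Qunit M) mxrank_ker.
  by rewrite mxrank_tr Prk; apply/eqP; lia.
exists P; split=> //; split=> // z.
(* The neutrality clause says that the conjugated rows of P(z) Q^-1 lie in the Shtraus subspace at
   the conjugate of z. By maximality they need only be orthogonal to the one at z, which P(z)^T
   annihilates. *)
apply: ctrans_eq0; rewrite ctransM ctransK; apply: trmx_inj.
rewrite trmx_mul trmx0; apply/sub_kermxP; rewrite -(eqmxP (PS _)).
apply: shtraus_maximal; rewrite ctrans_trC ctransK -mulmxA -trmx_mul mulmxKV //.
by apply/sub_kermxP; rewrite (eqmxP (PS _)).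
Qed.

End ModelToPolynomial.

(** * From polynomials to models *)

Section RowBasis.
Variable F : fieldType.

Lemma row_basis m n r (A : 'M[F]_(m, n)) : \rank A = r ->
  exists2 B : 'M_(r, n), row_free B & (B :=: A)%MS.
Proof. by case: r /; exists (row_base A); [apply: row_base_free | apply: eq_row_base]. Qed.

Lemma rank_mul_inj m n p (A : 'M[F]_(m, n)) (B : 'M_(n, p)) :
  (forall v : 'rV_n, (v <= A)%MS -> v *m B = 0 -> v = 0) -> \rank (A *m B) = \rank A.
Proof.
move=> AB; apply/eqP; have := mxrank_mul_ker A B; set K := (A :&: _)%MS => <-.
rewrite -[X in X == _]addn0 eqn_add2l eq_sym mxrank_eq0; apply/eqP/row_matrixP => i.
rewrite row0; have := row_sub i K; rewrite sub_capmx => /andP[vA /sub_kermxP vB].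
exact: AB.
Qed.

End RowBasis.

Section PolynomialToModel.
Context {R : realType}.
Local Notation C := R[i].
Local Notation "A ^:C" := (map_mx polyC A) (at level 2, left associativity, format "A ^:C").
Variables (d : nat) (Q : 'M[C]_(2 * d)) (P : 'M[{poly C}]_(d, 2 * d)).
Hypotheses (Qunit : Q \in unitmx) (Qherm : ctrans Q = Q) (PQP : PQ Q P).

Let mu j := (row_size P j).-1.

(* The state space consists of the polynomial row vectors f whose j-th entry has
   degree below mu j, with basis the rows of [monomials]; the relation is formed
   by the triples (c, f, g) with g(z) = z f(z) + c P(z)^T. *)
Let state := {j : 'I_d & 'I_(mu j)}.
Let n := #|{: state}|.

Let monomials : 'M[{poly C}]_(n, d) :=
  \matrix_(i < n, j < d) let s : state := enum_val i in
    if tag s == j then 'X^(tagged s) else 0.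

Let monomials_coef k (x : 'M[C]_(k, n)) l j t :
  ((x^:C *m monomials) l j)`_t =
    \sum_(s : state | (tag s == j) && (tagged s == t :> nat)) x l (enum_rank s).
Proof.
rewrite mxE coef_sum (reindex_onto (@enum_rank state) (@enum_val state {: state})) /=; last first.
  by move=> i _; rewrite enum_valK.
rewrite (eq_bigl xpredT); last by move=> s; rewrite enum_rankK eqxx.
rewrite [RHS]big_mkcond; apply: eq_bigr => s _; rewrite !mxE enum_rankK coefCM.
rewrite (fun_if (fun p : {poly C} => p`_t)) coef0 coefXn (eq_sym t).
by case: (tag s == j); case: eqP => _ /=; rewrite ?mulr1 ?mulr0.
Qed.

Let monomials_coef_in k (x : 'M[C]_(k, n)) l j (t : 'I_(mu j)) :
  ((x^:C *m monomials) l j)`_t = x l (enum_rank (Tagged (fun j => 'I_(mu j)) t)).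
Proof.
rewrite monomials_coef; apply: big_pred1 => s /=.
apply/idP/eqP => [|->]; last by rewrite /= !eqxx.
case: s => i s /= /andP[/eqP ij]; case: j / ij t => t /eqP/val_inj -> //.
Qed.

Let monomials_size k (x : 'M[C]_(k, n)) l j :
  (size ((x^:C *m monomials) l j) <= mu j)%N.
Proof.
apply/leq_sizeP => t jt; rewrite monomials_coef big1 // => -[i s] /= /andP[/eqP ij /eqP st].
by case: j / ij jt => it; have := ltn_ord s; rewrite st ltnNge it.
Qed.

Let monomials_inj k (x : 'M[C]_(k, n)) : x^:C *m monomials = 0 -> x = 0.
Proof.
move=> xm; apply/matrixP => l s; rewrite -[s]enum_valK.
case: (enum_val s) => j t; rewrite -monomials_coef_in xm !mxE coef0 //.
Qed.

Let monomials_surj k (f : 'M[{poly C}]_(k, d)) :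
  (forall l j, (size (f l j) <= mu j)%N) -> exists x : 'M_(k, n), f = x^:C *m monomials.
Proof.
move=> fmu; exists (\matrix_(l, i) let s : state := enum_val i in (f l (tag s))`_(tagged s)).
apply/matrixP => l j; apply/polyP => t; have [tj|jt] := ltnP t (mu j).
  by rewrite (monomials_coef_in _ _ (Ordinal tj)) mxE enum_rankK.
rewrite !nth_default ?(leq_trans (fmu _ _)) //.
exact: leq_trans (monomials_size _ _ _) jt.
Qed.

(** Represents the map from (c, f) to c P^T + z f. *)
Let full : 'M[{poly C}]_(2 * d + n, d) := col_mx P^T ('X *: monomials).

(** The coefficients of degree [mu j], the only ones by which c P^T + z f can leave the state space;
    its kernel is therefore the relation. *)
Let top : 'M[C]_(2 * d + n, d) := \matrix_(i, j) (full i j)`_(mu j).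

Let full_coef k (u : 'M[C]_(k, 2 * d + n)) l j t :
  ((u^:C *m full) l j)`_t = \sum_i u l i * (full i j)`_t.
Proof.
by rewrite mxE coef_sum; apply: eq_bigr => i _; rewrite mxE coefCM.
Qed.

Let full_size i j : (size (full i j) <= (mu j).+1)%N.
Proof.
rewrite -(splitK i); case: (split i) => {}i.
  case: PQP => _ _ _ _ /(_ j) Pj; rewrite col_mxEu mxE prednK //.
  exact: size_row_size.
rewrite col_mxEd mxE; apply: leq_trans (size_polyMleq _ _) _.
rewrite size_polyX /= ltnS; have := monomials_size (delta_mx 0 i : 'rV_n) 0 j.
suff -> : ((delta_mx 0 i : 'rV[C]_n)^:C *m monomials) 0 j = monomials i j by [].
by rewrite map_delta_mx -rowE mxE.
Qed.

Let lead_top : usubmx top = (lead_row_mx P)^T.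
Proof. by apply/matrixP => i j; rewrite mxE mxE col_mxEu !mxE. Qed.

(** The P-part of [top] is the transposed leading row matrix, whose rank d is a clause of [PQ]. It
    leaves a kernel of dimension (2d+n) - d, as a model requires. *)
Let top_rank : \rank top = d.
Proof.
apply/eqP; rewrite -/(row_full top); apply: row_fullP_col => y topy.
apply: (row_full_mul_eq0 (A := (lead_row_mx P)^T)).
  by case: PQP => _ _ Plead _ _; rewrite /row_full mxrank_tr Plead.
by move/eqP: topy; rewrite -[top]vsubmxK mul_col_mx col_mx_eq0 lead_top => /andP[/eqP].
Qed.

(** The second clause is the value at infinity: for f = 0 the boundary row c is killed by the
    leading row matrix, just as on the kernel at z it is killed by P(z). *)
Let state_model : exists (Cc : 'M[C]_(d + n, 2 * d)) (E F : 'M[C]_(d + n, n)),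
  [/\ row_free (row_mx Cc E),
      forall v : 'rV_(d + n), v *m E = 0 -> v *m Cc *m (lead_row_mx P)^T = 0 &
      F^:C *m monomials = Cc^:C *m P^T + 'X *: (E^:C *m monomials)].
Proof.
have rk : \rank (kermx top) = (d + n)%N by rewrite mxrank_ker top_rank; lia.
have [B Bfree Btop] := row_basis rk.
have {}Btop : B *m top = 0 by apply/sub_kermxP; rewrite Btop.
have [l j|F FE] := @monomials_surj _ (B^:C *m full).
  apply/leq_sizeP => t; rewrite leq_eqVlt => /predU1P[<-|jt]; rewrite full_coef.
    transitivity ((B *m top) l j); last by rewrite Btop mxE.
    by rewrite mxE; apply: eq_bigr => i _; rewrite [top _ _]mxE.
  by rewrite big1 // => i _; rewrite nth_default ?mulr0 // (leq_trans (full_size _ _)).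
exists (lsubmx B), (rsubmx B), F; rewrite hsubmxK; split=> //.
  move=> v vE; have := congr1 (mulmx v) Btop; rewrite mulmx0 mulmxA.
  rewrite -[B]hsubmxK mul_mx_row vE -[top]vsubmxK mul_row_col mul0mx addr0.
  by rewrite lead_top row_mxKl.
rewrite -FE -[B in LHS]hsubmxK map_row_mx mul_row_col; congr (_ + _).
by rewrite scalemxAr.
Qed.

Lemma polynomial_model : exists n (G : 'M[C]_n) (Cc : 'M[C]_(d + n, 2 * d)) E F,
  lagrangian_model Q G Cc E F /\
  forall z, (shtraus Cc E F z == kermx (mxeval P z)^T)%MS.
Proof.
have [Cc [E [F [CEfree leadE FE]]]] := state_model.
have Prank z : \rank (mxeval P z) = d by case: PQP.
have Pneutral z : mxeval P z *m invmx Q *m ctrans (mxeval P (Num.conj z)) = 0 by case: PQP.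
have op (v : 'rV_(d + n)) : v *m Cc = 0 -> v *m E = 0 -> v = 0.
  by move=> vC vE; apply: (row_free_mul_eq0 CEfree); rewrite mul_mx_row vC vE row_mx0.
(* On the kernel at a one has g = a f, so g = z f + c P^T determines f explicitly as c P(z)^T / (a -
   z). The reproducing kernel arises from this quotient. *)
have evalFE k (v : 'M_(k, d + n)) a z : v *m F = a *: (v *m E) ->
    (a - z) *: (v *m E *m mxeval monomials z) = v *m Cc *m (mxeval P z)^T.
  move=> vF; have := congr1 (fun A => v *m mxeval A z) FE.
  rewrite mxevalD mxevalZ !mxevalM mxeval_tr !mxevalC hornerX mulmxDr.
  rewrite mulmxA vF -scalemxAr !mulmxA -scalemxAl => /eqP.
  by rewrite -subr_eq -scalerBl => /eqP.
have eig z (v : 'rV_(d + n)) : v *m Cc = 0 -> v *m F = z *: (v *m E) -> v = 0.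
  move=> vC vF; apply: op => //; apply: monomials_inj.
  apply: (@scalepoly_inj _ _ _ ('X - z%:P)); first by rewrite polyXsubC_eq0.
  apply: mxeval_inj => w; rewrite scaler0 mxeval0 mxevalZ mxevalM mxevalC !hornerE.
  by rewrite -opprB scaleNr (evalFE _ _ _ _ vF) vC mul0mx oppr0.
have kerC z : (pencil_ker E F z *m Cc <= kermx (mxeval P z)^T)%MS.
  apply/sub_kermxP; rewrite -(evalFE _ _ z z); last by apply/pencil_kerP.
  by rewrite subrr scale0r.
have rank_kerP z : \rank (kermx (mxeval P z)^T) = d.
  by rewrite mxrank_ker mxrank_tr Prank; lia.
have rank_kerC z : \rank (pencil_ker E F z *m Cc) = \rank (pencil_ker E F z).
  apply: rank_mul_inj => v /pencil_kerP vF vC; exact: (eig z).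
(* With d+n rows and n columns the kernel has dimension at least d, and [Cc] embeds it into the
   d-dimensional kernel of P(z)^T. *)
have pfull z : row_full (F - z *: E).
  have := mxrankS (kerC z); rewrite rank_kerC rank_kerP mxrank_ker /row_full.
  have := rank_leq_col (F - z *: E); have := rank_leq_row (F - z *: E).
  by rewrite eqn_leq => ? -> /=; lia.
(* The same count at infinity, with the leading row matrix in place of P(z). *)
have Efull : row_full E.
  have : (kermx E *m Cc <= kermx (lead_row_mx P)^T)%MS.
    apply/row_subP => i; apply/sub_kermxP; rewrite -row_mul -mulmxA row_mul.
    by rewrite mulmxA; apply: leadE; rewrite -row_mul mulmx_ker row0.
  move=> /mxrankS; rewrite rank_mul_inj => [|v /sub_kermxP vE vC]; last exact: op.
  rewrite !mxrank_ker mxrank_tr; case: PQP => _ _ -> _ _; rewrite /row_full.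
  have := rank_leq_col E; have := rank_leq_row E.
  by rewrite eqn_leq => ? -> /=; lia.
have shP z : (shtraus Cc E F z == kermx (mxeval P z)^T)%MS.
  have [_ <-] := mxrank_leqif_eq (kerC z).
  by rewrite rank_kerC rank_kerP mxrank_ker (eqP (pfull z)); apply/eqP; lia.
(* The choice makes pairing with [q z] the evaluation c P(z^* )^T. By the neutrality clause these d
   independent rows lie in the Shtraus subspace at z, hence form a basis of it. *)
pose q z : 'M[C]_(d, 2 * d) := ctrans (invmx Q^T *m (mxeval P (Num.conj z))^T).
have qQ z : Q^T *m ctrans (q z) = (mxeval P (Num.conj z))^T.
  by rewrite ctransK mulKVmx // unitmx_tr.
have qker z : (q z <= shtraus Cc E F z)%MS.
  rewrite (eqmxP (shP z)); apply/sub_kermxP; apply: ctrans_inj.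
  rewrite ctrans0 ctransM ctransK; apply: trmx_inj; rewrite trmx0 !trmx_mul trmxK.
  rewrite -trmx_inv trmxK ctrans_trC trmxK.
  by have := Pneutral (Num.conj z); rewrite conjCK.
have /choice[v vP] : forall z, exists v : 'M_(d, d + n),
    q z = v *m Cc /\ v *m F = z *: (v *m E).
  by move=> z; apply/shtrausP.
have vC z : v z *m Cc = q z by case: (vP z).
have vF z : v z *m F = z *: (v z *m E) by case: (vP z).
have qrank z : \rank (q z) = d.
  rewrite rank_ctrans eqmxMfull ?mxrank_tr ?Prank //.
  by rewrite row_full_unit unitmx_inv unitmx_tr.
pose vn (k : nat) := v (node k).
have [K [A A1]] : exists K (A : 'I_K -> 'M[C]_(d + n, d)), 1%:M = \sum_k A k *m vn k.
  have [K] := pencil_kernels_span (@node_inj R) Efull pfull.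
  move=> /sub_sumsmxP[u uE].
  have kerv z : (pencil_ker E F z <= v z)%MS.
    have vk : (v z <= pencil_ker E F z)%MS by apply/pencil_kerP.
    suff /andP[] : (v z == pencil_ker E F z)%MS by [].
    have [_ <-] := mxrank_leqif_eq vk; rewrite eqn_leq mxrankS //=.
    by rewrite -rank_kerC (eqmxP (shP z)) rank_kerP -{1}(qrank z) -vC mxrankM_maxl.
  exists K, (fun k => u k *m pencil_ker E F (node k) *m pinvmx (v (node k))).
  by rewrite uE; apply: eq_bigr => k _; rewrite mulmxKpV // mulmx_sub.
(* By neutrality the Gram matrix G to be found must satisfy G (v z E)^* = gamma z:
   the gammas are the reproducing kernel vectors. This prescribes G, as the v's
   at the nodes span. *)
pose gamma z := - 'i *: mxeval monomials (Num.conj z).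
(* The factor -i in [gamma] is 1/i from Lagrange's identity: dividing by i(a - z^* ) cancels the
   factor a - z^* of [evalFE]. *)
have gammaE k (w : 'M_(k, d + n)) a z : a - Num.conj z != 0 -> w *m F = a *: (w *m E) ->
    w *m E *m gamma z = (- 'i / (a - Num.conj z)) *: (w *m Cc *m Q^T *m ctrans (q z)).
  move=> az wF; rewrite -(mulmxA _ Q^T) qQ -(evalFE _ _ _ _ wF) scalerA mulfVK //.
  by rewrite -scalemxAr.
pose gn (k : nat) := gamma (node k).
have hermH j k : ctrans (vn j *m E *m gn k) = vn k *m E *m gn j.
  rewrite /vn /gn !(gammaE _ _ _ _ (@conj_node_neq R _ _) (vF _)) !vC.
  rewrite ctransZ !ctransM ctransK -(ctrans_trC Q) Qherm mulmxA; congr (_ *: _).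
  rewrite rmorphM rmorphN /= conjCi opprK fmorphV rmorphB /= conjCK.
  by rewrite -[X in _ / X]opprB invrN mulrN mulNr.
(* The value that G times the adjoint of E must have, obtained by expanding E along
   [A k *m vn k]. *)
pose Gam := \sum_(k < K) gn k *m ctrans (A k).
have [E' EE] : exists E', E' *m E = 1%:M by exists (pinvmx E); rewrite mulVpmx.
have EE' : ctrans E *m ctrans E' = 1%:M by rewrite -ctransM EE ctrans1.
have [G GE] : exists G, G = Gam *m ctrans E' by eexists.
have vGam k : ctrans (vn k *m E *m Gam) = E *m gn k.
  rewrite /Gam mulmx_sumr ctrans_sum -[E in RHS]mul1mx A1 !mulmx_suml.
  by apply: eq_bigr => j _; rewrite [_ *m E *m (_ *m _)]mulmxA ctransM ctransK hermH !mulmxA.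
have EGam : ctrans (E *m Gam) = E *m Gam.
  rewrite [RHS]mulmx_sumr -[E in LHS]mul1mx A1 -mulmxA mulmx_suml ctrans_sum.
  apply: eq_bigr => j _.
  by rewrite -mulmxA ctransM mulmxA vGam mulmxA.
(* Consistency of the prescription: [E'] is only a left inverse of E, and it is the hermiticity of
   [E Gam] that recovers all of [Gam]. *)
have GamE : Gam = G *m ctrans E.
  apply: (row_full_inj Efull) => /=; rewrite GE !mulmxA -EGam ctransM.
  by rewrite -(mulmxA (ctrans Gam)) EE' mulmx1.
have Gherm : ctrans G = G.
  apply: (row_full_inj Efull) => /=.
  apply: (row_free_inj (A := ctrans E)); first by rewrite /row_free rank_ctrans.
  by rewrite /= -[RHS]mulmxA -GamE -EGam GamE !ctransM ctransK.
have gnE k : gn k = G *m ctrans (vn k *m E).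
  by apply: (row_full_inj Efull) => /=; rewrite -vGam GamE mulmxA !ctransM !ctransK Gherm !mulmxA.
exists n, G, Cc, E, F; split=> //; split=> //.
(* Nondegeneracy: if y G = 0, the reproducing property makes the polynomial vector of y vanish at
   the conjugates of all nodes. *)
- rewrite -row_free_unit; apply: row_freeP_row => y yG; apply: monomials_inj.
  apply: (@mxeval_seq_inj _ _ _ _ _ (fun k => Num.conj (node k))).
    by move=> j k /(can_inj (@conjCK _))/node_inj.
  move=> k; rewrite mxeval0 mxevalM mxevalC.
  apply: (scalerI (a := - 'i)); first by rewrite oppr_eq0 neq0Ci.
  by rewrite scaler0 scalemxAr -/(gamma (node k)) -/(gn k) gnE mulmxA yG mul0mx.
(* Neutrality is tested on the spanning rows [vn j] and [vn k], where it is [gammaE] read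
   backwards. *)
set X := _ + _; rewrite -[X]mul1mx -[X in _ *m X]mulmx1 -[X in _ *m (_ *m X)]ctrans1.
rewrite A1 ctrans_sum mulmx_suml big1 // => j _.
rewrite !mulmx_sumr big1 // => k _; rewrite ctransM -!mulmxA.
suff -> : vn j *m (X *m (ctrans (vn k) *m ctrans (A k))) = 0 by rewrite mulmx0.
rewrite !mulmxA -[RHS](mul0mx _ (ctrans (A k))); congr (_ *m _).
have vjk := gammaE _ _ _ _ (@conj_node_neq R j k) (vF (node j)).
rewrite /X mulmxDr mulmxDl -scalemxAr -scalemxAl mulmxBr mulmxBl.
have -> : vn j *m (Cc *m Q^T *m ctrans Cc) *m ctrans (vn k) =
    q (node j) *m Q^T *m ctrans (q (node k)).
  by rewrite -!vC ctransM !mulmxA.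
have -> : vn j *m (E *m G *m ctrans F) *m ctrans (vn k) = Num.conj (node k) *: (vn j *m E *m gn k).
  by rewrite gnE -(ctransK (vn k)) -!mulmxA -ctransM !ctransK vF ctransZ -!scalemxAr.
have -> : vn j *m (F *m G *m ctrans E) *m ctrans (vn k) = node j *: (vn j *m E *m gn k).
  by rewrite gnE -!mulmxA -ctransM mulmxA vF -scalemxAl !mulmxA.
rewrite -scalerBl vjk vC !scalerA -[X in X + _]scale1r -scalerDl.
rewrite -(opprB (node j)) mulrN (mulNr 'i) mulrNN mulrACA divff ?conj_node_neq // mulr1.
by rewrite mulCii subrr scale0r.
Qed.

End PolynomialToModel.

(** * Krein spaces *)

Section Completeness.
Context {R : realType}.
Local Notation C := R[i].

(** The limit is found as the supremum of the numbers eventually below the sequence. *)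
Lemma real_complete (u : nat -> R) :
  (forall e, 0 < e -> exists N, forall m n, (N <= m)%N -> (N <= n)%N -> `|u m - u n| < e) ->
  exists l, forall e, 0 < e -> exists N, forall n, (N <= n)%N -> `|u n - l| < e.
Proof.
move=> cu; pose A := [set x | exists N, forall n, (N <= n)%N -> x <= u n].
have Alb e N : (forall m n, (N <= m)%N -> (N <= n)%N -> `|u m - u n| < e) -> A (u N - e).
  move=> uN; exists N => n Nn; have := uN _ _ Nn (leqnn N).
  by rewrite ltr_norml; lra.
have Aub e N x : (forall m n, (N <= m)%N -> (N <= n)%N -> `|u m - u n| < e) -> A x -> x <= u N + e.
  move=> uN [N' N'x]; have := uN _ _ (leq_maxl N N') (leqnn N).
  by have := N'x _ (leq_maxr N N'); rewrite ltr_norml; lra.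
have [N1 uN1] := cu 1 ltr01.
have A0 : A !=set0 by exists (u N1 - 1); apply: Alb.
have Aubd : has_ubound A by exists (u N1 + 1) => x; apply: Aub.
exists (sup A) => e e0; have [|N uN] := cu (e / 2); first by rewrite divr_gt0.
exists N => n Nn; have := uN _ _ Nn (leqnn N); rewrite !ltr_norml.
have : u N - e / 2 <= sup A by apply: ub_le_sup => //; apply: Alb.
have : sup A <= u N + e / 2 by apply: ge_sup => // x; apply: Aub.
lra.
Qed.

Lemma complex_pos (e : C) : 0 < e -> exists2 r : R, 0 < r & e = r%:C.
Proof. by case: e => a b; rewrite ltcE /= => /andP[/eqP-> a0]; exists a. Qed.

Lemma normc_sq (z : C) : `|z| ^+ 2 = (complex.Re z ^+ 2 + complex.Im z ^+ 2)%:C.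
Proof.
rewrite normCK; case: z => a b; apply/eqP; rewrite eq_complex /=.
by apply/andP; split; apply/eqP; ring.
Qed.

Lemma complex_complete (u : nat -> C) :
  (forall e : C, 0 < e -> exists N, forall m n, (N <= m)%N -> (N <= n)%N ->
     `|u m - u n| ^+ 2 < e) ->
  exists l, forall e : C, 0 < e -> exists N, forall n, (N <= n)%N -> `|u n - l| ^+ 2 < e.
Proof.
move=> cu.
have cuR e : 0 < e -> exists N, forall m n, (N <= m)%N -> (N <= n)%N ->
    `|complex.Re (u m) - complex.Re (u n)| < e /\ `|complex.Im (u m) - complex.Im (u n)| < e.
  move=> e0; have [|N uN] := cu (e ^+ 2)%:C; first by rewrite ltcR exprn_gt0.
  exists N => m n Nm Nn; have := uN _ _ Nm Nn; rewrite normc_sq ltcR !raddfB /=.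
  set a := (complex.Re _ - _); set b := (_ - complex.Im _) => ab.
  by split; rewrite -ltr_sqr ?nnegrE ?(ltW e0) ?normr_ge0 // real_normK ?num_real //; nra.
have [|a ua] := @real_complete (fun n => complex.Re (u n)).
  by move=> e /cuR[N uN]; exists N => m n Nm Nn; case: (uN _ _ Nm Nn).
have [|c uc] := @real_complete (fun n => complex.Im (u n)).
  by move=> e /cuR[N uN]; exists N => m n Nm Nn; case: (uN _ _ Nm Nn).
exists (Complex a c) => _ /complex_pos[r r0 ->].
(* As e <= 1, the two squares add up to less than 2 e^2 <= 2 e <= r. *)
pose e := Num.min 1 (r / 2).
have e0 : 0 < e by rewrite lt_min ltr01 divr_gt0.
have e1 : e <= 1 by rewrite ge_min lexx.
have er : e <= r / 2 by rewrite ge_min lexx orbT.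
have [N uN] := ua e e0; have [N' uN'] := uc e e0.
exists (maxn N N') => n; rewrite geq_max => /andP[/uN + /uN'].
rewrite normc_sq ltcR !raddfB /= !ltr_norml.
set s := (complex.Re _ - _); set t := (complex.Im _ - _); nra.
Qed.

Definition row_norm n (x : 'rV[C]_n) : C := (x *m ctrans x) 0 0.

Lemma row_normE n (x : 'rV[C]_n) : row_norm x = \sum_i `|x 0 i| ^+ 2.
Proof. by rewrite /row_norm mxE; apply: eq_bigr => i _; rewrite !mxE normCK. Qed.

Lemma row_norm_ge0 n (x : 'rV[C]_n) : 0 <= row_norm x.
Proof. by rewrite row_normE sumr_ge0 // => i _; rewrite exprn_ge0. Qed.

Lemma row_norm_eq0 n (x : 'rV[C]_n) : row_norm x = 0 -> x = 0.
Proof.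
rewrite row_normE => /eqP; rewrite psumr_eq0 => [/allP x0|i _]; last by rewrite exprn_ge0.
apply/rowP => i; rewrite mxE; apply/eqP.
by have := x0 i (mem_index_enum i); rewrite expf_eq0 /= normr_eq0.
Qed.

Lemma row_complete n (u : nat -> 'rV[C]_n) :
  (forall e : C, 0 < e -> exists N, forall m n, (N <= m)%N -> (N <= n)%N ->
     row_norm (u m - u n) < e) ->
  exists l, forall e : C, 0 < e -> exists N, forall n, (N <= n)%N -> row_norm (u n - l) < e.
Proof.
move=> cu.
have /choice[l lP] : forall i, exists l, forall e : C, 0 < e ->
    exists N, forall n, (N <= n)%N -> `|u n 0 i - l| ^+ 2 < e.
  move=> i; apply: complex_complete => e /cu[N uN]; exists N => m k Nm Nk.
  apply: le_lt_trans (uN _ _ Nm Nk); rewrite row_normE (bigD1 i) //= !mxE.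
  by rewrite lerDl sumr_ge0 // => j _; rewrite exprn_ge0.
exists (\row_i l i) => e e0.
(* Dividing by n+1 covers n = 0 and keeps the total n e / (n+1) strictly below e. *)
have e'0 : 0 < e / n.+1%:R by rewrite divr_gt0 ?ltr0Sn.
have /choice[N NP] : forall i, exists N, forall k, (N <= k)%N ->
    `|u k 0 i - l i| ^+ 2 < e / n.+1%:R.
  by move=> i; apply: lP.
exists (\max_i N i)%N => k Nk; rewrite row_normE.
apply: (@le_lt_trans _ _ (\sum_(i < n) e / n.+1%:R)).
  apply: ler_sum => i _; rewrite !mxE; apply/ltW/NP.
  by apply: leq_trans Nk; apply: leq_bigmax.
rewrite sumr_const card_ord -(mulr_natr (e / _)) -mulrA (mulrC _^-1) -[ltRHS]mulr1 ltr_pM2l //.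
by rewrite ltr_pdivrMr ?ltr0Sn // mul1r ltr_nat.
Qed.

End Completeness.

(** * Diagonalisation of an invertible Hermitian matrix to signs *)

Section Sylvester.
Context {R : realType}.
Local Notation C := R[i].

(** The signs are wanted because a diagonal matrix of signs is an involution, so it is itself a
    fundamental symmetry of the space it defines. *)
Lemma hermitian_signature n (G : 'M[C]_n) : G \in unitmx -> ctrans G = G ->
  exists (N : 'M[C]_n) (s : 'rV[C]_n),
    [/\ N \in unitmx, forall i, s 0 i = 1 \/ s 0 i = -1 & G = N *m diag_mx s *m ctrans N].
Proof.
move=> Gu Gh.
have Gherm : G \is hermsymmx.
  by apply/is_hermitianmxP; rewrite expr0 scale1r -[LHS]Gh.
have /orthomx_spectralP := hermitian_normalmx Gherm.
have sreal := hermitian_spectral_diag_real Gherm.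
set U := spectralmx G; set D := spectral_diag G => GE.
have Uu : U \in unitmx := spectral_unit G.
have UV : invmx U = ctrans U by rewrite invmx_unitary ?spectral_unitarymx.
have D0 i : D 0 i != 0.
  apply: contraTneq Gu => Di; rewrite GE !unitmx_mul unitmx_inv Uu andbT /=.
  by rewrite unitmxE det_diag unitfE (bigD1 i) //= Di mul0r eqxx.
have Dreal i : D 0 i \is Num.real by apply/mxOverP.
pose r : 'rV[C]_n := \row_i sqrtC `|D 0 i|.
pose s : 'rV[C]_n := \row_i Num.sg (D 0 i).
exists (ctrans U *m diag_mx r), s; split.
- rewrite unitmx_mul unitmx_ctrans Uu /= unitmxE det_diag unitfE.
  by apply/prodf_neq0 => i _; rewrite mxE sqrtC_eq0 normr_eq0.
- move=> i; rewrite mxE; have := Dreal i; rewrite realE => /orP[] Di.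
    by left; rewrite gtr0_sg // lt_neqAle eq_sym D0.
  by right; rewrite ltr0_sg // lt_neqAle D0.
rewrite GE UV ctransM ctransK -!mulmxA; congr (_ *m _); rewrite !mulmxA; congr (_ *m _).
rewrite /ctrans tr_diag_mx map_diag_mx !mulmx_diag; congr diag_mx.
apply/rowP => i; rewrite !mxE /= conj_Creal ?ger0_real ?sqrtC_ge0 //.
by rewrite mulrAC -expr2 sqrtCK mulrC -realEsg.
Qed.

End Sylvester.

(** * Inner products and orthogonal sums with a coordinate space *)

Section KreinForms.
Context {R : realType}.
Local Notation C := R[i].

Section Ip.
Context {K : kreinSpace R}.
Implicit Types x y z : K.

Lemma ipC x y : ip y x = Num.conj (ip x y).
Proof. by rewrite /ip [LHS]hermitian_subproof expr0 mul1r. Qed.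

Lemma ip0l x : ip 0 x = 0.
Proof. exact: linear0l. Qed.

Lemma ip0r x : ip x 0 = 0.
Proof. exact: linear0r. Qed.

Lemma ipDl x y z : ip (x + y) z = ip x z + ip y z.
Proof. exact: linearDl. Qed.

Lemma ipDr x y z : ip x (y + z) = ip x y + ip x z.
Proof. exact: linearDr. Qed.

Lemma ipZl a x y : ip (a *: x) y = a * ip x y.
Proof. exact: linearZl_LR. Qed.

Lemma ipZr a x y : ip x (a *: y) = Num.conj a * ip x y.
Proof. exact: linearZr_LR. Qed.

Lemma ip_suml (I : Type) (r : seq I) (P : pred I) (f : I -> K) y :
  ip (\sum_(i <- r | P i) f i) y = \sum_(i <- r | P i) ip (f i) y.
Proof. exact: linear_sumlz. Qed.

Lemma ip_sumr (I : Type) (r : seq I) (P : pred I) (f : I -> K) y :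
  ip y (\sum_(i <- r | P i) f i) = \sum_(i <- r | P i) ip y (f i).
Proof. exact: linear_sumr. Qed.

Lemma ip_nondegenerate x : (forall y, ip y x = 0) -> x = 0.
Proof.
case: (kreinP K) => J [_ _ Jpos _] x0; apply/eqP; apply: contraT => /Jpos.
by rewrite /sqnorm -/(ip _ _) x0 ltxx.
Qed.

Lemma ip_eq0C x y : ip x y = 0 -> ip y x = 0.
Proof. by move=> xy; rewrite ipC xy rmorph0. Qed.

Lemma green_eq0 (k k' : K * K) : green k k' = 0 <-> ip k'.2 k.1 = ip k'.1 k.2.
Proof.
split=> [/eqP|kk].
  rewrite mulf_eq0 (negPf (neq0Ci _)) subr_eq0 => /eqP kk.
  by rewrite [LHS]ipC [RHS]ipC kk.
by rewrite /green [ip k.1 _]ipC kk -ipC subrr mulr0.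
Qed.

Lemma self_adjointP (T : set (K * K)) : self_adjoint T <->
  is_subspace T /\ forall k, T k <-> forall k', T k' -> green k k' = 0.
Proof.
split=> -[Tsub TE]; split=> //.
  move=> k; rewrite {1}TE; split=> Tk k' Tk'; first by apply/green_eq0/Tk.
  by apply/green_eq0/Tk.
apply/seteqP; split=> k.
  by move=> /TE Tk k' Tk'; apply/green_eq0/Tk.
by move=> Tk; apply/TE => k' Tk'; apply/green_eq0/Tk.
Qed.

End Ip.

Variables (H K : kreinSpace R) (n : nat).

(** The common description of given and of constructed extensions: [phi] parametrises the complement
    of the small space by rows, with Gram matrix [G]. *)
Record orthogonal_sum (iota : {linear H -> K}) (phi : {linear 'rV[C]_n -> K})
    (G : 'M[C]_n) : Prop := OrthogonalSum {
  osum_isometry : forall x y, ip (iota x) (iota y) = ip x y;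
  osum_gram : forall x y, ip (phi x) (phi y) = (x *m G *m ctrans y) 0 0;
  osum_ortho : forall h x, ip (iota h) (phi x) = 0;
  osum_decomp : forall k, exists h x, k = iota h + phi x;
  osum_unit : G \in unitmx }.

Section OrthogonalSum.
Variables (iota : {linear H -> K}) (phi : {linear 'rV[C]_n -> K}) (G : 'M[C]_n).
Hypothesis KHG : orthogonal_sum iota phi G.

Lemma osum_ip h h' x x' :
  ip (iota h + phi x) (iota h' + phi x') = ip h h' + (x *m G *m ctrans x') 0 0.
Proof.
rewrite ipDl !ipDr (osum_isometry KHG) (osum_gram KHG) (osum_ortho KHG) addr0.
by rewrite [X in _ + (X + _)]ip_eq0C ?(osum_ortho KHG) // add0r.
Qed.

Lemma osum_eq0 h x : iota h + phi x = 0 -> h = 0 /\ x = 0.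
Proof.
move=> hx; split.
  apply: ip_nondegenerate => h'; have := osum_ip h' h 0 x.
  by rewrite hx ip0r !mul0mx mxE addr0.
apply: (row_free_mul_eq0 (A := G)); first by rewrite row_free_unit (osum_unit KHG).
apply/rowP => i; have := osum_ip h 0 x (delta_mx 0 i).
rewrite hx ip0l ip0r add0r [RHS]mxE => /esym; rewrite mxE (bigD1 i) //= big1 ?addr0.
  by rewrite !mxE !eqxx rmorph1 mulr1.
by move=> j /negPf ji; rewrite !mxE ji andbF rmorph0 mulr0.
Qed.

Lemma osum_inj h h' x x' : iota h + phi x = iota h' + phi x' -> h = h' /\ x = x'.
Proof.
move=> /eqP; rewrite -subr_eq0 opprD addrACA -!raddfB => /eqP/osum_eq0[/eqP + /eqP].
by rewrite !subr_eq0 => /eqP-> /eqP->.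
Qed.

Lemma osum_complP k : ortho_compl iota k <-> exists x, k = phi x.
Proof.
split=> [kH|[x ->] h]; last exact: osum_ortho KHG _ _.
have [h [x kE]] := osum_decomp KHG k; exists x.
suff h0 : h = 0 by rewrite kE h0 raddf0 add0r.
apply: ip_nondegenerate => h'; have := osum_ip h' h 0 x.
by rewrite !mul0mx mxE addr0 -kE raddf0 addr0 kH.
Qed.

Lemma osum_herm : ctrans G = G.
Proof.
have GE i j : G i j = ip (phi (delta_mx 0 i)) (phi (delta_mx 0 j)).
  by rewrite (osum_gram KHG) /ctrans trmx_delta map_delta_mx -rowE -colE !mxE.
by apply/matrixP => i j; rewrite !mxE !GE -ipC.
Qed.

Lemma osum_green h1 h2 h1' h2' x y x' y' :
  green (iota h1 + phi x, iota h2 + phi y) (iota h1' + phi x', iota h2' + phi y') =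
    green (h1, h2) (h1', h2')
      + ('i *: (x *m G *m ctrans y' - y *m G *m ctrans x')) 0 0.
Proof.
rewrite /green /= !osum_ip !mxE -mulrDr; congr (_ * _).
by rewrite opprD addrACA.
Qed.

End OrthogonalSum.

End KreinForms.

(** * Extensions in coordinates *)

Section BoundaryForm.
Context {R : realType}.
Local Notation C := R[i].
Variables (H : kreinSpace R) (S : set (H * H)) (d : nat).
Variables (b : H * H -> 'cV[C]_(2 * d)) (Q : 'M[C]_(2 * d)).
Hypotheses (hS : symmetric_relation S) (hb : boundary_mapping S b) (hQ : gram_matrix S b Q).

Lemma adjoint_subspace : is_subspace (adjoint S).
Proof.
split=> [x _|a k k' Sk Sk' x Sx]; first by rewrite !ip0r.
by rewrite /= !ipDr !ipZr Sk // Sk'.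
Qed.

Lemma sub_adjoint k : S k -> adjoint S k.
Proof. by case: hS => _; apply. Qed.

Lemma boundaryP a k k' : adjoint S k -> adjoint S k' -> b (a *: k + k') = a *: b k + b k'.
Proof. by case: hb => blin _ _; apply: blin. Qed.

Lemma boundary_ker k : adjoint S k -> (b k = 0 <-> S k).
Proof. by case: hb => _ _; apply. Qed.

Lemma boundary_surj (c : 'rV[C]_(2 * d)) : exists2 k, adjoint S k & (b k)^T = c.
Proof. by case: hb => _ /(_ c^T)[k Sk bk] _; exists k; rewrite // bk trmxK. Qed.

Lemma boundary_diff k k' : adjoint S k -> adjoint S k' -> b k = b k' -> S (k - k').
Proof.
move=> Sk Sk' kk; have Skk : adjoint S (k - k').
  by rewrite -scaleN1r addrC; exact: (adjoint_subspace.2 _ _ _ Sk' Sk).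
apply/(boundary_ker Skk); rewrite -scaleN1r addrC boundaryP // kk scaleN1r.
by rewrite addNr.
Qed.

Lemma Q_unit : Q \in unitmx. Proof. by case: hQ. Qed.

(** Green's form in coordinates. The transpose of Q comes from reading the scalar b(k')^* Q b(k) in
    terms of the rows b(k)^T and b(k')^T. *)
Definition lagrange_form n (G : 'M[C]_n) k l (c : 'M[C]_(k, 2 * d)) (x y : 'M_(k, n))
    (c' : 'M[C]_(l, 2 * d)) (x' y' : 'M_(l, n)) : 'M_(k, l) :=
  c *m Q^T *m ctrans c' + 'i *: (x *m G *m ctrans y' - y *m G *m ctrans x').

Section InSum.
Variables (K : kreinSpace R) (n : nat) (iota : {linear H -> K}).
Variables (phi : {linear 'rV[C]_n -> K}) (G : 'M[C]_n).
Hypothesis KHG : orthogonal_sum iota phi G.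

Lemma green_lagrange h1 h2 h1' h2' x y x' y' :
  adjoint S (h1, h2) -> adjoint S (h1', h2') ->
  green (iota h1 + phi x, iota h2 + phi y) (iota h1' + phi x', iota h2' + phi y') =
    lagrange_form G (b (h1, h2))^T x y (b (h1', h2'))^T x' y' 0 0.
Proof.
move=> Sh Sh'; rewrite (osum_green KHG) /lagrange_form [RHS]mxE; congr (_ + _).
case: hQ => _ _ _ ->//; transitivity ((ctrans (b (h1', h2')) *m Q *m b (h1, h2))^T 0 0).
  by rewrite [RHS]mxE.
by rewrite !trmx_mul mulmxA ctrans_trC.
Qed.

Definition represents (T : set (K * K)) (Cc : 'M[C]_(d + n, 2 * d)) (E F : 'M[C]_(d + n, n)) :=
  forall h1 h2 x y, T (iota h1 + phi x, iota h2 + phi y) <->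
    adjoint S (h1, h2) /\
    exists v : 'rV_(d + n), [/\ (b (h1, h2))^T = v *m Cc, x = v *m E & y = v *m F].

Lemma pair_decomp (k : K * K) :
  exists h1 h2 x y, k = (iota h1 + phi x, iota h2 + phi y).
Proof.
case: k => f g; have [h1 [x ->]] := osum_decomp KHG f.
by have [h2 [y ->]] := osum_decomp KHG g; exists h1, h2, x, y.
Qed.

Lemma pair_lin a h1 h2 h1' h2' x y x' y' :
  a *: (iota h1 + phi x, iota h2 + phi y) + (iota h1' + phi x', iota h2' + phi y') =
  (iota (a *: h1 + h1') + phi (a *: x + x'), iota (a *: h2 + h2') + phi (a *: y + y')).
Proof. by apply/pair_equal_spec; split; rewrite /= !linearP scalerDr addrACA. Qed.

Lemma adjoint_of_green h1 h2 x y :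
  (forall s, S s -> green (iota h1 + phi x, iota h2 + phi y) (iota s.1, iota s.2) = 0) ->
  adjoint S (h1, h2).
Proof.
move=> gS s /gS/green_eq0; rewrite -[iota s.1]addr0 -[iota s.2]addr0 -(raddf0 phi) /=.
by rewrite !(osum_ip KHG) !mul0mx mxE !addr0.
Qed.

Lemma represents_selfadj T Cc E F :
    lagrangian_model Q G Cc E F -> represents T Cc E F ->
  [/\ self_adjoint T, forall k, S k -> T (iota k.1, iota k.2) &
      let Shat := T `&` (ortho_compl iota `*` ortho_compl iota) in
      is_operator Shat /\ no_eigenvalue Shat].
Proof.
move=> M TP.
have T0 : T 0.
  rewrite [0](_ : _ = (iota 0 + phi 0, iota 0 + phi 0)); last by rewrite !raddf0 addr0.
  apply/TP; split; first exact: adjoint_subspace.1.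
  exists 0; rewrite !mul0mx; split=> //; apply/eqP; rewrite trmx_eq0; apply/eqP.
  by apply/(boundary_ker adjoint_subspace.1); case: hS => -[].
have ext k : S k -> T (iota k.1, iota k.2).
  case: k => h1 h2 Sk /=; rewrite -[iota h1]addr0 -[iota h2]addr0 -{1 2}(raddf0 phi).
  apply/TP; split; first exact: sub_adjoint.
  exists 0; rewrite !mul0mx; split=> //; apply/eqP; rewrite trmx_eq0; apply/eqP.
  exact/(boundary_ker (sub_adjoint Sk)).
have Thb h1 h2 x y : T (iota h1 + phi x, iota h2 + phi y) -> exists v : 'rV_(d + n),
    [/\ adjoint S (h1, h2), (b (h1, h2))^T = v *m Cc, x = v *m E & y = v *m F].
  by move=> /TP[Sh [v [bv xv yv]]]; exists v.
split=> //.
  apply/self_adjointP; split.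
    split=> // a k k'; have [h1 [h2 [x [y ->]]]] := pair_decomp k.
    have [h1' [h2' [x' [y' ->]]]] := pair_decomp k'.
    move=> /Thb[v [Sh bv -> ->]] /Thb[w [Sh' bw -> ->]]; rewrite pair_lin.
    apply/TP; split; first exact: (adjoint_subspace.2 a _ _ Sh Sh').
    exists (a *: v + w); rewrite !mulmxDl -!scalemxAl; split=> //.
    by rewrite (boundaryP _ Sh Sh') linearP /= bv bw.
  move=> k; have [h1 [h2 [x [y ->]]]] := pair_decomp k; split.
    move=> /Thb[v [Sh bv -> ->]] k'; have [h1' [h2' [x' [y' ->]]]] := pair_decomp k'.
    move=> /Thb[w [Sh' bw -> ->]]; rewrite green_lagrange // bv bw.
    have -> : lagrange_form G (v *m Cc) (v *m E) (v *m F) (w *m Cc) (w *m E) (w *m F)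
        = v *m lagrange_form G Cc E F Cc E F *m ctrans w.
      rewrite /lagrange_form mulmxDr mulmxDl -scalemxAr -scalemxAl mulmxBr mulmxBl.
      by rewrite !ctransM !mulmxA.
    by rewrite [lagrange_form _ _ _ _ _ _ _](model_neutral M) mulmx0 mul0mx mxE.
  move=> kT; have Sh : adjoint S (h1, h2).
    by apply: (adjoint_of_green (x := x) (y := y)) => s /ext/kT.
  (* Orthogonality to T need only be used on the rows of the model; each lifts to an element of T
     because b is onto. *)
  have [|v [bv xv yv]] := @model_maximal _ _ _ Q_unit _ _ _ _ _ M _ (b (h1, h2))^T x y.
    apply/rowP => j; rewrite [RHS]mxE.
    pose v := delta_mx 0 j : 'rV[C]_(d + n).
    have [[h1' h2'] Sh' bv] := boundary_surj (v *m Cc).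
    have Tv : T (iota h1' + phi (v *m E), iota h2' + phi (v *m F)).
      by apply/TP; split=> //; exists v.
    have := kT _ Tv; rewrite green_lagrange // bv => <-.
    rewrite /lagrange_form !ctransM !mulmxA -mulmxBl scalemxAl -mulmxDl.
    move: (_ + _) => X.
    by rewrite /v /ctrans trmx_delta map_delta_mx -colE [RHS]mxE.
  by apply/TP; split=> //; exists v.
have TE x y : T (phi x, phi y) -> exists v : 'rV_(d + n),
    [/\ v *m Cc = 0, x = v *m E & y = v *m F].
  rewrite -[phi x]add0r -[phi y]add0r -{1 2}(raddf0 iota) => /Thb[v [_ bv xv yv]].
  exists v; split=> //; rewrite -bv; apply/eqP; rewrite trmx_eq0; apply/eqP.
  by apply/(boundary_ker adjoint_subspace.1); case: hS => -[].
split.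
  move=> g [Tg [_ /(osum_complP KHG)[y /= gE]]]; move: Tg; rewrite gE.
  rewrite -{1}(raddf0 phi) => /TE[v [vC vE ->]].
  by rewrite (model_op M vC (esym vE)) mul0mx raddf0.
move=> l f [Tf [/(osum_complP KHG)[x /= fE] _]]; move: Tf; rewrite fE.
rewrite -linearZ => /TE[v [vC vE vF]].
by rewrite vE (model_eig M vC (z := l)) ?mul0mx ?raddf0 // -vE.
Qed.

(** The coordinate triples of T form a subspace [D]. Since b is onto, self-adjointness of T makes
    [D] its own annihilator for a nondegenerate form in dimension 2d+2n, which forces dimension
    d+n. *)
Lemma model_of_selfadj T :
    self_adjoint T -> (forall k, S k -> T (iota k.1, iota k.2)) ->
    (let Shat := T `&` (ortho_compl iota `*` ortho_compl iota) in
      is_operator Shat /\ no_eigenvalue Shat) ->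
  exists Cc E F, lagrangian_model Q G Cc E F /\ represents T Cc E F.
Proof.
move=> /self_adjointP[Tsub TP] ext [op eig].
have Sadj h1 h2 x y : T (iota h1 + phi x, iota h2 + phi y) -> adjoint S (h1, h2).
  move=> /TP kT; apply: (adjoint_of_green (x := x) (y := y)) => s /ext/kT //.
(* Elements of the adjoint with equal boundary values differ by S, which T contains; so membership
   in T depends on the H-part only through b. *)
have Tshift h1 h2 h1' h2' x y : T (iota h1 + phi x, iota h2 + phi y) ->
    adjoint S (h1', h2') -> b (h1', h2') = b (h1, h2) ->
    T (iota h1' + phi x, iota h2' + phi y).
  move=> Tk Sh' bh; have := boundary_diff Sh' (Sadj _ _ _ _ Tk) bh.
  move=> /ext /= /(Tsub.2 1)/(_ Tk); rewrite scale1r !raddfB.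
  by congr T; apply/pair_equal_spec; rewrite /= !addrA !subrK.
pose D (u : 'rV[C]_(2 * d + (n + n))) := exists h : H * H,
  [/\ adjoint S h, (b h)^T = lsubmx u &
      T (iota h.1 + phi (lsubmx (rsubmx u)), iota h.2 + phi (rsubmx (rsubmx u)))].
have b0 : b 0 = 0.
  by apply/(boundary_ker adjoint_subspace.1); case: hS => -[].
have D0 : D 0.
  exists 0; split; [exact: adjoint_subspace.1 | by rewrite b0 !linear0 |].
  by rewrite !linear0 /= !addr0; apply: Tsub.1.
have Dlin a u u' : D u -> D u' -> D (a *: u + u').
  move=> [[h1 h2] [Sh bh Th]] [[h1' h2'] [Sh' bh' Th']]; exists (a *: (h1, h2) + (h1', h2')).
  split; first exact: (adjoint_subspace.2 a _ _ Sh Sh').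
    by rewrite (boundaryP _ Sh Sh') !linearP /= bh bh'.
  have := Tsub.2 a _ _ Th Th'; rewrite pair_lin.
  by rewrite !linearP.
have [r [B [Bfree DB]]] := row_subspaceP D0 Dlin.
pose N := dual_mx Q G (lsubmx B) (lsubmx (rsubmx B)) (rsubmx (rsubmx B)).
have Bsplit : row_mx (lsubmx B) (row_mx (lsubmx (rsubmx B)) (rsubmx (rsubmx B))) = B.
  by rewrite !hsubmxK.
have Nrank : \rank N = r by rewrite rank_dual_mx ?Q_unit ?(osum_unit KHG) // Bsplit.
have mulN (u : 'rV_(2 * d + (n + n))) : u *m N =
    lagrange_form G (lsubmx u) (lsubmx (rsubmx u)) (rsubmx (rsubmx u))
      (lsubmx B) (lsubmx (rsubmx B)) (rsubmx (rsubmx B)).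
  by rewrite /lagrange_form -mul_dual_mx !hsubmxK.
have Dcoord h1 h2 x y : T (iota h1 + phi x, iota h2 + phi y) ->
    D (row_mx (b (h1, h2))^T (row_mx x y)).
  move=> Tk; exists (h1, h2); rewrite !row_mxKl !row_mxKr !row_mxKl; split=> //.
  exact: Sadj Tk.
have NB : (kermx N == B)%MS.
  apply/andP; split; apply/row_subP => i.
    set u := row i _; have uN : u *m N = 0 by apply/sub_kermxP; rewrite row_sub.
    apply/DB; have [[h1 h2] Sh bh] := boundary_surj (lsubmx u).
    exists (h1, h2); split=> //=; apply/TP => k'.
    have [h1' [h2' [x' [y' ->]]]] := pair_decomp k' => Tk'.
    have /DB/submxP[w wE] := Dcoord _ _ _ _ Tk'.
    rewrite green_lagrange ?bh //; last exact: Sadj Tk'.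
    move: wE; rewrite -{1}Bsplit !mul_mx_row => /eq_row_mx[-> /eq_row_mx[-> ->]].
    have := congr1 (fun A => A *m ctrans w) (mulN u).
    rewrite uN mul0mx /lagrange_form mulmxDl -scalemxAl mulmxBl.
    by rewrite !ctransM !mulmxA => <-; rewrite mxE.
  apply/sub_kermxP; set u := row i B; have /DB[[h1 h2] [Sh bh Tu]] : (u <= B)%MS by rewrite row_sub.
  rewrite mulN; apply/rowP => j; rewrite [RHS]mxE.
  have /DB[[h1' h2'] [Sh' bh' Tj]] : (row j B <= B)%MS by rewrite row_sub.
  have := (TP _).1 Tu _ Tj; rewrite green_lagrange // bh bh' => <-.
  have [e [eE rowe]] : exists e : 'rV_r, e = delta_mx 0 j /\ row j B = e *m B.
    by eexists; split; last exact: rowE.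
  have -> : lagrange_form G (lsubmx u) (lsubmx (rsubmx u)) (rsubmx (rsubmx u))
      (lsubmx (row j B)) (lsubmx (rsubmx (row j B))) (rsubmx (rsubmx (row j B)))
    = lagrange_form G (lsubmx u) (lsubmx (rsubmx u)) (rsubmx (rsubmx u))
      (lsubmx B) (lsubmx (rsubmx B)) (rsubmx (rsubmx B)) *m ctrans e.
    rewrite rowe -!mulmx_rsub -!mulmx_lsub.
    by rewrite /lagrange_form mulmxDl -scalemxAl mulmxBl !ctransM !mulmxA.
  by rewrite eE /ctrans trmx_delta map_delta_mx -colE [RHS]mxE.
have rE : r = (d + n)%N.
  have /eqmxP[+ _] := NB; rewrite mxrank_ker Nrank (eqP Bfree); lia.
have {mulN Nrank} [C' [E' [F' [CEFfree DCEF]]]] :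
    exists (C' : 'M[C]_(d + n, 2 * d)) (E' F' : 'M[C]_(d + n, n)),
    let B' := row_mx C' (row_mx E' F') in
    row_free B' /\ forall u, [/\ D u <-> (u <= B')%MS & D u <-> u *m dual_mx Q G C' E' F' = 0].
  case: (d + n)%N / rE; exists (lsubmx B), (lsubmx (rsubmx B)), (rsubmx (rsubmx B)).
  rewrite /= Bsplit; split=> // u; split; first exact: DB.
  split=> [/DB uB|uN]; first by apply/sub_kermxP; rewrite (eqmxP NB).
  by apply/DB; rewrite -(eqmxP NB); apply/sub_kermxP.
have DE v : D (v *m row_mx C' (row_mx E' F')) by apply/(proj1 (DCEF _)); rewrite submxMl.
have Tker v : v *m C' = 0 -> T (phi (v *m E'), phi (v *m F')).
  move=> vC; have [[h1 h2] [Sh bh]] := DE v.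
  rewrite !mul_mx_row !(row_mxKl, row_mxKr) vC in bh *.
  move=> Tv; rewrite -[phi (_ *m E')]add0r -[phi (_ *m F')]add0r -{1 2}(raddf0 iota).
  apply: (Tshift _ _ _ _ _ _ Tv); first exact: adjoint_subspace.1.
  by rewrite (_ : (0, 0) = 0 :> H * H) // b0; apply: trmx_inj; rewrite bh trmx0.
have inc x : ortho_compl iota (phi x) by apply/(osum_complP KHG); exists x.
have phi_inj x : phi x = 0 -> x = 0.
  by move=> px; have := @osum_eq0 _ _ _ _ _ _ _ KHG 0 x; rewrite px raddf0 addr0 => -[].
have opM (v : 'rV_(d + n)) : v *m C' = 0 -> v *m E' = 0 -> v = 0.
  move=> vC vE; apply: (row_free_mul_eq0 CEFfree).
  have := Tker v vC; rewrite vE raddf0 => TvF.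
  have /phi_inj vF : phi (v *m F') = 0.
    apply: op; split=> //; split; last exact: inc.
    by have := inc 0; rewrite raddf0.
  by rewrite !mul_mx_row vC vE vF !row_mx0.
exists C', E', F'; split.
  split=> //; [exact: osum_unit KHG | exact: osum_herm KHG | |].
    rewrite -mul_dual_mx; apply/row_matrixP => i; rewrite row_mul row0.
    by apply/(proj2 (DCEF _)); rewrite rowE.
  move=> z v vC vF; apply: opM => //; apply: phi_inj.
  apply: (eig z); split; last by split=> //=; rewrite -linearZ.
  by rewrite -linearZ -vF; apply: Tker.
move=> h1 h2 x y; split=> [Tk|[Sh [v [bv -> ->]]]].
  split; first exact: Sadj Tk.
  have [+ _] := DCEF (row_mx (b (h1, h2))^T (row_mx x y)).
  move=> /iffLR/(_ (Dcoord _ _ _ _ Tk))/submxP[v].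
  by rewrite !mul_mx_row => /eq_row_mx[bv /eq_row_mx[xv yv]]; exists v.
have [[h1' h2'] [Sh' bh']] := DE v; rewrite !mul_mx_row !(row_mxKl, row_mxKr) in bh' *.
by move=> Tv; apply: (Tshift _ _ _ _ _ _ Tv) => //; apply: trmx_inj; rewrite bv bh'.
Qed.

End InSum.
End BoundaryForm.

(** * Bases of finite-dimensional subspaces *)

Section Lincomb.
Context {R : realType} {V : lmodType R[i]} {n : nat}.
Variable e : 'I_n -> V.

Definition lincomb (x : 'rV[R[i]]_n) : V := \sum_i x 0 i *: e i.

Lemma lincomb_is_linear : linear lincomb.
Proof.
move=> a x y; rewrite /lincomb scaler_sumr -big_split; apply: eq_bigr => i _.
by rewrite !mxE scalerDl scalerA.
Qed.

HB.instance Definition _ := GRing.isLinear.Build R[i] 'rV[R[i]]_n V *:%R lincomb lincomb_is_linear.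

End Lincomb.

Section FiniteDimension.
Context {R : realType} {V : lmodType R[i]}.

Lemma lincomb_mul n k (e : 'I_n -> V) (B : 'M[R[i]]_(k, n)) x :
  lincomb e (x *m B) = lincomb (fun i => lincomb e (row i B)) x.
Proof.
rewrite mulmx_sum_row raddf_sum; apply: eq_bigr => i _; exact: linearZ.
Qed.

(** The linear relations among the spanning vectors form a row space; coefficients taken from a
    complement of it give a basis. *)
Lemma finite_dim_basis (D : set V) : is_subspace D -> finite_dim D ->
  exists n (phi : {linear 'rV[R[i]]_n -> V}), injective phi /\
    forall k, D k <-> exists x, k = phi x.
Proof.
move=> Dsub [n [e [De Dspan]]].
pose Z (x : 'rV[R[i]]_n) := lincomb e x = 0.
have [||r [B [_ ZB]]] := @row_subspaceP _ _ Z; first exact: raddf0.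
  by move=> a u v Zu Zv; rewrite /Z linearP /= Zu Zv scaler0 addr0.
have [B' B'free B'E] := row_basis (erefl (\rank B^C%MS)).
exists _, (lincomb (fun i => lincomb e (row i B'))); split.
  move=> x y /eqP; rewrite -subr_eq0 -raddfB /= -lincomb_mul => /eqP /ZB xyB.
  apply/eqP; rewrite -subr_eq0; apply/eqP/(row_free_mul_eq0 B'free).
  apply/eqP; rewrite -submx0 -(capmx_compl B) sub_capmx xyB -B'E submxMl //.
have Dlin x : D (lincomb e x).
  rewrite /lincomb; elim/big_ind: _ => [|u v Du Dv|i _]; first exact: Dsub.1.
    by rewrite -[u]scale1r; apply: Dsub.2.
  by rewrite -[X in D X]addr0; apply: Dsub.2 => //; exact: Dsub.1.
move=> k; split=> [/Dspan[c ->]|[x ->]]; last by rewrite /= -lincomb_mul.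
have : (c^T <= B + B^C)%MS by rewrite submx_full // addsmx_compl_full.
move=> /sub_addsmxP[[u1 u2] /= cE].
have : (u2 *m B^C <= B')%MS by rewrite B'E submxMl.
move=> /submxP[x xE]; exists x; rewrite -lincomb_mul -xE.
transitivity (lincomb e c^T); first by apply: eq_bigr => i _; rewrite mxE.
rewrite cE raddfD /= [X in X + _](_ : _ = 0) ?add0r //.
by apply/ZB; rewrite submxMl.
Qed.

End FiniteDimension.

Section Extensions.
Context {R : realType}.
Local Notation C := R[i].
Variables (H : kreinSpace R) (S : set (H * H)).

Lemma extension_sum (A : extension S) :
  exists n (phi : {linear 'rV[C]_n -> ext_space A}) G,
    orthogonal_sum (ext_inj A) phi G.
Proof.
have [|n [phi [phi_inj phiP]]] := finite_dim_basis _ (ext_findim A).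
  split=> [h|a x y xH yH h]; first exact: ip0r.
  by rewrite ipDr ipZr xH yH mulr0 addr0.
pose G : 'M[C]_n := \matrix_(i, j) ip (phi (delta_mx 0 i)) (phi (delta_mx 0 j)).
have phiH x : ortho_compl (ext_inj A) (phi x) by apply/phiP; exists x.
have phiZ a x : phi (a *: x) = a *: phi x by exact: linearZ_LR.
have gram x y : ip (phi x) (phi y) = (x *m G *m ctrans y) 0 0.
  rewrite {1}(row_sum_delta x) {1}(row_sum_delta y) !raddf_sum ip_sumr mxE.
  apply: eq_bigr => j _; rewrite ip_suml [in RHS]mxE mulr_suml.
  by apply: eq_bigr => i _; rewrite /= !phiZ ipZl ipZr !mxE mulrA mulrAC.
have decomp k : exists h x, k = ext_inj A h + phi x.
  have [h /phiP[x kE]] := ext_decomp k; exists h, x.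
  by rewrite -kE addrC subrK.
exists n, phi, G; split=> //; [exact: ext_isometry | by move=> h x; apply: phiH |].
(* If x G = 0, then [phi x] is orthogonal to the complement as well as to H, hence zero. *)
rewrite -row_free_unit; apply: row_freeP_row => x xG; apply: phi_inj.
rewrite raddf0; apply: ip_nondegenerate => k; have [h [y ->]] := decomp k.
by rewrite ipDl phiH add0r ipC gram xG mul0mx mxE rmorph0.
Qed.

(** With f and g split along H and its complement, g - z f lies in H exactly when the complement
    part of g is z times that of f. *)
Lemma T_ext_coord (A : extension S) n (phi : {linear 'rV[C]_n -> ext_space A}) G z y :
    orthogonal_sum (ext_inj A) phi G ->
  T_ext A z y <-> exists x, @ext_rel _ _ _ A
    (ext_inj A y.1 + phi x, ext_inj A y.2 + phi (z *: x)).
Proof.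
move=> KHG; case: y => y1 y2 /=; split.
  move=> [f [g [Afg [h _ gzf] pf pg]]].
  have [x /= fE] := (osum_complP KHG _).1 pf; have [x' /= gE] := (osum_complP KHG _).1 pg.
  have {}fE : f = ext_inj A y1 + phi x by rewrite -fE addrC subrK.
  have {}gE : g = ext_inj A y2 + phi x' by rewrite -gE addrC subrK.
  have [_ /eqP] : y2 - z *: y1 - h = 0 /\ x' - z *: x = 0.
    apply: (osum_eq0 KHG); rewrite !linearB !linearZ /= gzf fE gE.
    rewrite !scalerN.
    have -> : ext_inj A y2 + phi x' - z *: (ext_inj A y1 + phi x) =
      ext_inj A y2 - z *: ext_inj A y1 + (phi x' - z *: phi x).
      by rewrite scalerDr opprD addrACA.
    by rewrite opprD addNKr addNr.
  by rewrite subr_eq0 => /eqP x'E; exists x; rewrite -x'E -fE -gE.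
move=> [x Ax]; exists (ext_inj A y1 + phi x), (ext_inj A y2 + phi (z *: x)); split=> //.
- exists (y2 - z *: y1) => //; rewrite !linearB !linearZ /=.
  by rewrite ?scalerN scalerDr opprD addrACA subrr addr0.
- by apply/(osum_complP KHG); exists x; rewrite addrC addKr.
- by apply/(osum_complP KHG); exists (z *: x); rewrite addrC addKr.
Qed.

Variables (d : nat) (b : H * H -> 'cV[C]_(2 * d)) (Q : 'M[C]_(2 * d)).
Hypotheses (hS : symmetric_relation S) (hb : boundary_mapping S b) (hQ : gram_matrix S b Q).

Lemma extension_model (A : extension S) :
  exists n (phi : {linear 'rV[C]_n -> ext_space A}) G Cc E F,
    [/\ orthogonal_sum (ext_inj A) phi G, lagrangian_model Q G Cc E F &
        represents S b (ext_inj A) phi (@ext_rel _ _ _ A) Cc E F].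
Proof.
have [n [phi [G KHG]]] := extension_sum A.
have [Cc [E [F [M rep]]]] := model_of_selfadj hS hb hQ KHG
  (ext_selfadj A) (@ext_extends _ _ _ A) (ext_minimal A).
by exists n, phi, G, Cc, E, F.
Qed.

Lemma T_extP (A : extension S) n (phi : {linear 'rV[C]_n -> ext_space A}) G Cc E F z y :
    orthogonal_sum (ext_inj A) phi G ->
    represents S b (ext_inj A) phi (@ext_rel _ _ _ A) Cc E F ->
  T_ext A z y <-> adjoint S y /\ ((b y)^T <= shtraus Cc E F z)%MS.
Proof.
move=> KHG rep; split=> [/(T_ext_coord _ _ KHG)[x /rep[]]|].
  rewrite -surjective_pairing => Sy [v [bv xv yv]]; split=> //.
  by apply/shtrausP; exists v; rewrite -xv.
move=> [Sy /shtrausP[v [bv vF]]]; apply/(T_ext_coord _ _ KHG); exists (v *m E).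
by apply/rep; rewrite -surjective_pairing; split=> //; exists v.
Qed.

End Extensions.

(** * The Krein space H plus C^n with a diagonal of signs *)

Section SignatureSum.
Context {R : realType}.
Local Notation C := R[i].
Variables (H : kreinSpace R) (n : nat) (s : 'rV[C]_n).

Let D := diag_mx s.

Definition signature_form (k k' : H * 'rV[C]_n) : C :=
  ip k.1 k'.1 + (k.2 *m D *m ctrans k'.2) 0 0.

Fact signature_form_bilinear :
  bilinear_for *%R (@Num.conj C \; *%R) signature_form.
Proof.
split=> k a x y; rewrite /signature_form /=.
  by rewrite ipDl ipZl !mulmxDl mulrDr -!scalemxAl !mxE addrACA.
by rewrite ipDr ipZr ctransD ctransZ mulmxDr mulrDr -!scalemxAr !mxE addrACA.
Qed.

HB.instance Definition _ := bilinear_isBilinear.Build C (H * 'rV[C]_n)%type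
  (H * 'rV[C]_n)%type C *%R (@Num.conj C \; *%R) signature_form signature_form_bilinear.

Hypothesis s_sign : forall i, s 0 i = 1 \/ s 0 i = -1.

Lemma signature_herm : ctrans D = D.
Proof.
rewrite /ctrans tr_diag_mx map_diag_mx; congr diag_mx.
by apply/rowP => i; rewrite mxE; case: (s_sign i) => ->; rewrite ?rmorphN rmorph1.
Qed.

Lemma signature_sq : D *m D = 1%:M.
Proof.
rewrite mulmx_diag -diag_const_mx; congr diag_mx.
by apply/rowP => i; rewrite !mxE; case: (s_sign i) => ->; rewrite ?mulrNN mulr1.
Qed.

Fact signature_form_herm k k' :
  signature_form k k' = (-1) ^+ false * Num.conj (signature_form k' k).
Proof.
rewrite expr0 mul1r /signature_form rmorphD /= -ipC; congr (_ + _).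
by rewrite -{1}signature_herm -{1}(ctransK k.2) -!ctransM mulmxA [LHS]mxE mxE.
Qed.

Definition signature_hermitian : {hermitian (H * 'rV[C]_n)%type for false & @Num.conj C} :=
  HB.pack signature_form (isHermitianSesquilinear.Build C (H * 'rV[C]_n)%type
    false (@Num.conj C) signature_form signature_form_herm).

Definition signature_symmetry (J : {linear H -> H}) (k : H * 'rV[C]_n) :
  H * 'rV[C]_n := (J k.1, k.2 *m D).

Fact signature_symmetry_linear J : linear (signature_symmetry J).
Proof.
by move=> a x y; apply/pair_equal_spec; split; rewrite /= ?linearP // mulmxDl scalemxAl.
Qed.

HB.instance Definition _ J := GRing.isLinear.Build C (H * 'rV[C]_n)%type
  (H * 'rV[C]_n)%type *:%R (signature_symmetry J) (signature_symmetry_linear J).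

(** Under this symmetry the second summand carries the Euclidean norm, so positivity and
    completeness can be checked on each summand. *)
Lemma signature_sqnorm (J : {linear H -> H}) k :
  sqnorm signature_hermitian (signature_symmetry J) k =
    sqnorm (krein_form H) J k.1 + row_norm k.2.
Proof.
rewrite /sqnorm /= /signature_form /= /ip /row_norm; congr (_ + _).
by rewrite -(mulmxA k.2) signature_sq mulmx1.
Qed.

Fact signature_symmetry_fundamental : exists J, fundamental_symmetry signature_hermitian J.
Proof.
have [J [JJ Jself Jpos Jcomplete]] := kreinP H; exists (signature_symmetry J).
have Jge0 h : 0 <= sqnorm (krein_form H) J h.
  have [->|/Jpos/ltW//] := eqVneq h 0.
  by rewrite /sqnorm linear0r.
split.
- case=> h x; apply/pair_equal_spec; split; first exact: JJ.
  by rewrite /= -mulmxA signature_sq mulmx1.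
- move=> k k'; rewrite /= /signature_form /= /ip Jself; congr (_ + _).
  by rewrite ctransM signature_herm !mulmxA.
- case=> h x hx; rewrite signature_sqnorm /=.
  have [h0|/Jpos h0] := eqVneq h 0; last by apply: ltr_pwDl h0 (row_norm_ge0 _).
  rewrite h0 /sqnorm linear0r add0r lt_neqAle row_norm_ge0 andbT eq_sym.
  by apply: contraNneq hx => /row_norm_eq0 ->; rewrite h0.
move=> u cu.
have [|h hP] := Jcomplete (fun k => (u k).1).
  move=> e e0; have [N uN] := cu e e0; exists N => j k Nj Nk.
  by apply: le_lt_trans (uN _ _ Nj Nk); rewrite signature_sqnorm lerDl row_norm_ge0.
have [|x xP] := @row_complete _ _ (fun k => (u k).2).
  move=> e e0; have [N uN] := cu e e0; exists N => j k Nj Nk.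
  by apply: le_lt_trans (uN _ _ Nj Nk); rewrite signature_sqnorm lerDr.
exists (h, x) => e e0; have e2 : 0 < e / 2 by rewrite divr_gt0.
have [N1 N1P] := hP _ e2; have [N2 N2P] := xP _ e2.
exists (maxn N1 N2) => k; rewrite geq_max => /andP[/N1P hk /N2P xk].
by rewrite signature_sqnorm [e]splitr ltrD.
Qed.

Definition signature_sum : kreinSpace R := KreinSpace signature_symmetry_fundamental.

Definition sum_inl (h : H) : signature_sum := (h, 0).
Definition sum_inr (x : 'rV[C]_n) : signature_sum := (0, x).

Fact sum_inl_linear : linear sum_inl.
Proof. by move=> a h h'; apply/pair_equal_spec; split; rewrite /= ?scaler0 ?addr0. Qed.

Fact sum_inr_linear : linear sum_inr.
Proof. by move=> a x x'; apply/pair_equal_spec; split; rewrite /= ?scaler0 ?addr0. Qed.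

HB.instance Definition _ := GRing.isLinear.Build C H signature_sum *:%R sum_inl sum_inl_linear.
HB.instance Definition _ :=
  GRing.isLinear.Build C 'rV[C]_n signature_sum *:%R sum_inr sum_inr_linear.

Lemma signature_sum_orthogonal : orthogonal_sum sum_inl sum_inr D.
Proof.
split.
- by move=> h h'; rewrite /ip /= /signature_form /= !mul0mx mxE addr0.
- by move=> x y; rewrite {1}/ip /= /signature_form /= ip0l add0r.
- by move=> h x; rewrite /ip /= /signature_form /= -/(ip _ _) ip0r !mul0mx mxE addr0.
- by case=> h x; exists h, x; apply/pair_equal_spec; split; rewrite /= ?addr0 ?add0r.
- by have /mulmx1_unit[] := signature_sq.
Qed.

End SignatureSum.

(** * Realisation of a model by an extension *)

Section ModelToExtension.
Context {R : realType}.
Local Notation C := R[i].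
Variables (H : kreinSpace R) (S : set (H * H)) (d : nat).
Variables (b : H * H -> 'cV[C]_(2 * d)) (Q : 'M[C]_(2 * d)).
Hypotheses (hS : symmetric_relation S) (hb : boundary_mapping S b) (hQ : gram_matrix S b Q).

Lemma model_change_basis n (G G' N : 'M[C]_n) Cc E F :
  N \in unitmx -> G' \in unitmx -> ctrans G' = G' -> G = N *m G' *m ctrans N ->
  lagrangian_model Q G Cc E F -> lagrangian_model Q G' Cc (E *m N) (F *m N).
Proof.
move=> Nu G'u G'h GE M; split=> //.
- by rewrite !ctransM -(model_neutral M) GE !mulmxA.
- move=> v vC vE; apply: (model_op M) => //; apply: (row_free_mul_eq0 (A := N)).
    by rewrite row_free_unit.
  by rewrite -mulmxA.
move=> z v vC vF; apply: (model_eig M (z := z)) => //.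
by apply: (row_free_inj (A := N)); rewrite ?row_free_unit // -scalemxAl -!mulmxA.
Qed.

Lemma shtraus_change_basis n (N : 'M[C]_n) (Cc : 'M[C]_(d + n, 2 * d)) E F z :
  N \in unitmx -> (shtraus Cc (E *m N) (F *m N) z == shtraus Cc E F z)%MS.
Proof.
move=> Nu; apply/andP; split; apply/shtrausP.
  have [v [-> vF]] := (shtrausP Cc (E *m N) (F *m N) z _).1 (submx_refl _).
  exists v; split=> //.
  by apply: (row_free_inj (A := N)); rewrite ?row_free_unit // -scalemxAl -!mulmxA.
have [v [-> vF]] := (shtrausP Cc E F z _).1 (submx_refl _).
by exists v; split=> //; rewrite !mulmxA vF -scalemxAl.
Qed.

Lemma model_extension n (G : 'M[C]_n) Cc E F : lagrangian_model Q G Cc E F ->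
  exists A : extension S, forall z y,
    T_ext A z y <-> adjoint S y /\ ((b y)^T <= shtraus Cc E F z)%MS.
Proof.
move=> M0; have [N [s [Nu s_sign GE]]] := hermitian_signature (model_unit M0) (model_herm M0).
have KHG := @signature_sum_orthogonal _ H n s s_sign.
have M := model_change_basis Nu (osum_unit KHG) (osum_herm KHG) GE M0.
set iota : {linear H -> signature_sum H s_sign} := @sum_inl _ H n s s_sign in KHG.
set phi : {linear 'rV[C]_n -> signature_sum H s_sign} := @sum_inr _ H n s s_sign in KHG.
pose T := [set k : signature_sum H s_sign * signature_sum H s_sign | exists h1 h2 x y,
  [/\ k = (iota h1 + phi x, iota h2 + phi y), adjoint S (h1, h2) & exists v : 'rV_(d + n),
    [/\ (b (h1, h2))^T = v *m Cc, x = v *m (E *m N) & y = v *m (F *m N)]]].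
have rep : represents S b iota phi T Cc (E *m N) (F *m N).
  move=> h1 h2 x y; split=> [|[Sh vP]]; last by exists h1, h2, x, y.
  move=> [h1' [h2' [x' [y' [/pair_equal_spec[fE gE] Sh vP]]]]].
  by have [-> ->] := osum_inj KHG fE; have [-> ->] := osum_inj KHG gE.
have [Tsa Text Tmin] := represents_selfadj hS hb hQ KHG M rep.
have fd : finite_dim (ortho_compl iota).
  exists n, (fun i => phi (delta_mx 0 i)); split.
    by move=> i; apply/(osum_complP KHG); exists (delta_mx 0 i).
  move=> k /(osum_complP KHG)[x ->]; exists x^T.
  rewrite {1}(row_sum_delta x) raddf_sum; apply: eq_bigr => i _.
  by rewrite [LHS]linearZ_LR mxE.
have dec k : exists h, ortho_compl iota (k - iota h).
  have [h [x ->]] := osum_decomp KHG k; exists h.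
  by apply/(osum_complP KHG); exists x; rewrite addrC addKr.
exists (Extension (osum_isometry KHG) dec Tsa Text fd Tmin) => z y.
have := @T_extP _ _ S d b (Extension (osum_isometry KHG) dec Tsa Text fd Tmin) n phi
  _ Cc (E *m N) (F *m N) z y KHG rep.
by rewrite (eqmxP (shtraus_change_basis Cc E F z Nu)).
Qed.

End ModelToExtension.

(** * Equivalence classes *)

Section Equivalences.
Context {R : realType}.
Local Notation C := R[i].
Variables (H : kreinSpace R) (S : set (H * H)) (d : nat).
Variables (b : H * H -> 'cV[C]_(2 * d)) (Q : 'M[C]_(2 * d)).
Hypotheses (hS : symmetric_relation S) (hb : boundary_mapping S b) (hQ : gram_matrix S b Q).

Let compl_subspace (A : extension S) : is_subspace (ortho_compl (ext_inj A)).
Proof.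
split=> [h|a x y xH yH h]; first exact: ip0r.
by rewrite ipDr ipZr xH yH mulr0 addr0.
Qed.

Let compl_unique (A : extension S) h h' (x x' : ext_space A) :
  ortho_compl (ext_inj A) x -> ortho_compl (ext_inj A) x' ->
  ext_inj A h + x = ext_inj A h' + x' -> h = h' /\ x = x'.
Proof.
have [n [phi [G KHG]]] := extension_sum A.
move=> /(osum_complP KHG)[{}x ->] /(osum_complP KHG)[{}x' ->].
by move=> /(osum_inj KHG)[-> ->].
Qed.

(** The map I (+) Psi fixes H-parts and commutes with multiplication by z on the complement, so it
    carries the defining pairs of one Shtraus subspace to those of the other. *)
Lemma ext_equiv_T (A1 A2 : extension S) z : ext_equiv A1 A2 -> T_ext A1 z = T_ext A2 z.
Proof.
move=> [Psi [[Plin [Pfun Pinj Psurj] _] /= UA]].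
have P0 x : ortho_compl (ext_inj A1) x -> Psi (z *: x) = z *: Psi x.
  move=> x1; have c0 := (compl_subspace A1).1; have := Plin 0 _ _ c0 c0.
  rewrite scale0r addr0 scale0r add0r => P00; have := Plin z _ _ x1 c0.
  have Psi0 : Psi 0 = 0.
    by have := Plin (-1) _ _ c0 c0; rewrite scaler0 addr0 scaleN1r addNr.
  by rewrite Psi0 !addr0.
have Uf (x : ext_space A1) h k : ortho_compl (ext_inj A1) x ->
    graph_id_sum (ext_inj A1) (ext_inj A2) Psi (ext_inj A1 h + x, k) ->
    k = ext_inj A2 h + Psi x.
  move=> x1 [h' [x' [x'1 [hx ->]]]].
  by have [-> ->] := compl_unique x1 x'1 hx.
have zcompl (A : extension S) (x : ext_space A) :
    ortho_compl (ext_inj A) x -> ortho_compl (ext_inj A) (z *: x).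
  by move=> xc h; rewrite ipZr xc mulr0.
have T_extE (A : extension S) y : T_ext A z y <-> exists x,
    ortho_compl (ext_inj A) x /\
    @ext_rel _ _ _ A (ext_inj A y.1 + x, ext_inj A y.2 + z *: x).
  have [n [phi [G KHG]]] := extension_sum A.
  split=> [/(T_ext_coord _ _ KHG)[x Ax]|[x [/(osum_complP KHG)[{}x ->]]]].
    by exists (phi x); split; [apply/(osum_complP KHG); exists x | rewrite -linearZ].
  by rewrite -linearZ => Ax; apply/(T_ext_coord _ _ KHG); exists x.
have Ugraph h x : ortho_compl (ext_inj A1) x -> graph_id_sum (ext_inj A1) (ext_inj A2)
    Psi (ext_inj A1 h + x, ext_inj A2 h + Psi x) by exists h, x.
apply/seteqP; split=> y /T_extE[x [xc Ax]]; apply/T_extE.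
  exists (Psi x); split; first exact: Pfun.
  set U := graph_id_sum _ _ _ in UA Uf Ugraph.
  have : rel_comp U (@ext_rel _ _ _ A1)
      (ext_inj A1 y.1 + x, ext_inj A2 y.2 + Psi (z *: x)).
    by exists (ext_inj A1 y.2 + z *: x); split=> //=; apply/Ugraph/zcompl.
  by rewrite UA P0 // => -[k [/= /Uf -> ]].
have [x1 x1c xE] := Psurj _ xc; exists x1; split=> //.
set U := graph_id_sum _ _ _ in UA Uf Ugraph.
have : rel_comp (@ext_rel _ _ _ A2) U
    (ext_inj A1 y.1 + x1, ext_inj A2 y.2 + z *: x).
  by exists (ext_inj A2 y.1 + x); split=> //=; rewrite -xE; apply: Ugraph.
rewrite -UA => -[g [/= A1g [h' [x' [x'1 [gE]]]]]].
rewrite -xE -P0 // => yE.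
have [yh /Pinj] := compl_unique (Pfun _ (zcompl _ _ x1c)) (Pfun _ x'1) yE.
rewrite !inE => /(_ (zcompl _ _ x1c) x'1) xx.
by move: A1g; rewrite gE -yh -xx.
Qed.

Lemma T_ext_equiv (A1 A2 : extension S) :
  (forall z, T_ext A1 z = T_ext A2 z) -> ext_equiv A1 A2.
Proof.
move=> TT.
have [n1 [phi1 [G1 [C1 [E1 [F1 [KHG1 M1 rep1]]]]]]] := extension_model hS hb hQ A1.
have [n2 [phi2 [G2 [C2 [E2 [F2 [KHG2 M2 rep2]]]]]]] := extension_model hS hb hQ A2.
have shsub n n' (A A' : extension S) (phi : {linear 'rV[C]_n -> ext_space A})
    (phi' : {linear 'rV[C]_n' -> ext_space A'}) G G' Cc C' E E' F F' :
    orthogonal_sum (ext_inj A) phi G -> orthogonal_sum (ext_inj A') phi' G' ->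
    represents S b (ext_inj A) phi (@ext_rel _ _ _ A) Cc E F ->
    represents S b (ext_inj A') phi' (@ext_rel _ _ _ A') C' E' F' ->
    (forall z, T_ext A z = T_ext A' z) ->
    forall z, (shtraus Cc E F z <= shtraus C' E' F' z)%MS.
  move=> KHG KHG' rep rep' TA z; apply/row_subP => i.
  have [y Sy yE] := boundary_surj hb (row i (shtraus Cc E F z)).
  rewrite -yE; apply: (proj2 (A := adjoint S y)).
  by apply/(T_extP z y KHG' rep'); rewrite -TA; apply/(T_extP z y KHG rep); rewrite yE row_sub.
have sh12 z : (shtraus C1 E1 F1 z == shtraus C2 E2 F2 z)%MS.
  apply/andP; split.
    exact: (shsub _ _ _ _ _ _ _ _ _ _ _ _ _ _ KHG1 KHG2 rep1 rep2 TT).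
  exact: (shsub _ _ _ _ _ _ _ _ _ _ _ _ _ _ KHG2 KHG1 rep2 rep1 (fun z => esym (TT z))).
have [Theta [U [Tfull Ufree Ufull UG [TC TE TF]]]] := models_isometry (Q_unit hQ) M1 M2 sh12.
have transfer h1 h2 x y :
    @ext_rel _ _ _ A1 (ext_inj A1 h1 + phi1 x, ext_inj A1 h2 + phi1 y) <->
    @ext_rel _ _ _ A2 (ext_inj A2 h1 + phi2 (x *m U), ext_inj A2 h2 + phi2 (y *m U)).
  split=> [/rep1|/rep2] [Sh [v [bv xv yv]]].
    apply/rep2; split=> //; exists (v *m Theta).
    by rewrite bv xv yv -!mulmxA -TC TE TF.
  apply/rep1; split=> //; have /submxP[w wE] : (v <= Theta)%MS by rewrite submx_full.
  exists w; rewrite bv TC mulmxA -wE; split=> //; apply: (row_free_inj Ufree) => /=.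
    by rewrite xv wE -!mulmxA TE.
  by rewrite yv wE -!mulmxA TF.
have /choice[xf xfP] : forall k, exists x, exists h, k = ext_inj A1 h + phi1 x.
  by move=> k; have [h [x kE]] := osum_decomp KHG1 k; exists x, h.
(* Defined on the whole space by discarding the H-part, as only the values on the complement
   matter. *)
pose Psi k := phi2 (xf k *m U).
have xfE h x : xf (ext_inj A1 h + phi1 x) = x.
  by have [h' /(osum_inj KHG1)[_ <-]] := xfP (ext_inj A1 h + phi1 x).
have PsiE x : Psi (phi1 x) = phi2 (x *m U).
  by rewrite /Psi -[phi1 x]add0r -(raddf0 (ext_inj A1)) xfE.
have graphE k1 k2 : graph_id_sum (ext_inj A1) (ext_inj A2) Psi (k1, k2) <->
    exists h x, k1 = ext_inj A1 h + phi1 x /\ k2 = ext_inj A2 h + phi2 (x *m U).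
  split=> [[h [_ [/(osum_complP KHG1)[x ->] /pair_equal_spec[-> ->]]]]|[h [x [-> ->]]]].
    by exists h, x; rewrite PsiE.
  by exists h, (phi1 x); rewrite PsiE; split=> //; apply/(osum_complP KHG1); exists x.
exists Psi; split; first split.
- move=> a _ _ /(osum_complP KHG1)[x ->] /(osum_complP KHG1)[y ->].
  by rewrite -linearP !PsiE mulmxDl -scalemxAl linearP.
- split.
  + move=> _ /(osum_complP KHG1)[x ->]; apply/(osum_complP KHG2).
    by exists (x *m U); rewrite PsiE.
  + move=> k k'; rewrite !inE => /(osum_complP KHG1)[x ->] /(osum_complP KHG1)[y ->].
    rewrite !PsiE => xy; congr (phi1 _); apply: (row_free_inj Ufree) => /=.
    by have [] := @osum_inj _ _ _ _ _ _ _ KHG2 0 0 (x *m U) (y *m U); rewrite ?xy.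
  + move=> _ /(osum_complP KHG2)[y ->]; exists (phi1 (y *m pinvmx U)).
      by apply/(osum_complP KHG1); exists (y *m pinvmx U).
    by rewrite PsiE -mulmxA mulVpmx // mulmx1.
- move=> _ _ /(osum_complP KHG1)[x ->] /(osum_complP KHG1)[y ->].
  by rewrite !PsiE (osum_gram KHG1) (osum_gram KHG2) ctransM -UG !mulmxA.
rewrite /=; apply/seteqP; split=> -[k1 k2] [k /=].
  have [h [x kE]] := osum_decomp KHG1 k1.
  move=> [A1k /graphE[h2 [y [kE' ->]]]]; move: A1k; rewrite kE kE' => /transfer A2k.
  exists (ext_inj A2 h + phi2 (x *m U)); split=> //.
  by apply/graphE; exists h, x.
move=> [/graphE[h [x [-> kE]]]]; rewrite kE.
have [h2 [y ->]] := osum_decomp KHG2 k2.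
rewrite -[y]mulmx1 -(mulVpmx Ufull) mulmxA => /transfer A1k.
by eexists; split; [exact: A1k | apply/graphE; do 2 eexists].
Qed.

Lemma T_polyP (P : 'M[{poly C}]_(d, 2 * d)) z y :
  T_poly S b P z y <-> adjoint S y /\ ((b y)^T <= kermx (mxeval P z)^T)%MS.
Proof.
have PbE : mxeval P z *m b y = 0 <-> ((b y)^T <= kermx (mxeval P z)^T)%MS.
  split=> [Pb|/sub_kermxP].
    by apply/sub_kermxP; rewrite -trmx_mul Pb trmx0.
  by rewrite -trmx_mul => Pb; apply: trmx_inj; rewrite Pb trmx0.
by split=> -[Sy /PbE].
Qed.

(** The kernel of P(z) determines its row space, so equal subspaces give polynomial factors in both
    directions. The factors are mutually inverse, hence [\det W] is a unit of the polynomial ring,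
    that is, a nonzero constant. *)
Lemma PQ_equivP (P1 P2 : {P : 'M[{poly C}]_(d, 2 * d) | PQ Q P}) :
  PQ_equiv P1 P2 <-> forall z, T_poly S b (sval P1) z = T_poly S b (sval P2) z.
Proof.
have rk (P : {P : 'M[{poly C}]_(d, 2 * d) | PQ Q P}) z : \rank (mxeval (sval P) z) = d.
  by case: P => P [].
have kersub (P P' : {P : 'M[{poly C}]_(d, 2 * d) | PQ Q P}) z :
    T_poly S b (sval P) z `<=` T_poly S b (sval P') z ->
    (kermx (mxeval (sval P) z)^T <= kermx (mxeval (sval P') z)^T)%MS.
  move=> PP; apply/row_subP => i.
  have [y Sy yE] := boundary_surj hb (row i (kermx (mxeval (sval P) z)^T)).
  rewrite -yE; apply: (proj2 (A := adjoint S y)); apply/T_polyP/PP/T_polyP.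
  by rewrite yE row_sub.
split.
  move=> [W [c c0 detW] WP] z; have Wz : mxeval W z \in unitmx.
    by rewrite unitmxE -mxeval_det detW hornerC unitfE.
  apply/seteqP; split=> y [Sy Py]; split=> //; first by rewrite WP -mulmxA Py mulmx0.
  apply: (row_full_mul_eq0 (A := mxeval W z)); first by rewrite row_full_unit.
  by rewrite mulmxA -WP.
move=> TT.
have rowsub (P P' : {P : 'M[{poly C}]_(d, 2 * d) | PQ Q P}) :
    (forall z, T_poly S b (sval P) z = T_poly S b (sval P') z) ->
    forall z, (mxeval (sval P') z <= mxeval (sval P) z)%MS.
  move=> TP z.
  have PK : ((cokermx (mxeval (sval P) z))^T <= kermx (mxeval (sval P) z)^T)%MS.
    by apply/sub_kermxP; rewrite -trmx_mul mulmx_coker trmx0.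
  have PP' : T_poly S b (sval P) z `<=` T_poly S b (sval P') z by rewrite TP.
  have /sub_kermxP := submx_trans PK (kersub P P' z PP').
  by rewrite -trmx_mul submxE => /(congr1 trmx); rewrite trmxK trmx0 => ->.
have [W WE] := polymx_factor (rk P1) (rowsub P1 P2 TT).
have [W' W'E] := polymx_factor (rk P2) (rowsub P2 P1 (fun z => esym (TT z))).
exists W; last by move=> z; rewrite WE mxevalM.
have W'W : W' *m W = 1%:M.
  apply: mxeval_inj => z; apply: (row_free_inj (A := mxeval (sval P1) z)).
    by rewrite /row_free rk.
  by rewrite /= -!mxevalM mul1mx -mulmxA -WE -W'E.
have : \det W \is a GRing.unit.
  by apply/unitrPr; exists (\det W'); rewrite mulrC -det_mulmx W'W det1.
rewrite poly_unitE => /andP[/size_poly1P[c c0 cE] _].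
by exists c.
Qed.

End Equivalences.

(** * Passage to equivalence classes *)

Lemma class_of_eq {T U : Type} (e : T -> T -> Prop) (f : T -> U) :
  (forall x y, e x y <-> f x = f y) ->
  forall x y, class_of e x = class_of e y <-> f x = f y.
Proof.
move=> ef x y; split=> [/(congr1 sval) /= exy|fxy].
  by apply/ef; rewrite exy; apply/ef.
apply: eq_exist => /=; apply/funext => t; apply/propext.
by rewrite !ef fxy.
Qed.

(** When [f] and [g] are complete invariants, the classes on both sides are points of one set [U]
    and the relation is equality there; bijectivity then means equal images. *)
Lemma bijective_relation_of_invariant {A B U : Type}
    (eA : A -> A -> Prop) (eB : B -> B -> Prop) (f : A -> U) (g : B -> U) :
    (forall x y, eA x y <-> f x = f y) -> (forall x y, eB x y <-> g x = g y) ->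
    (forall a, exists b, f a = g b) -> (forall b, exists a, f a = g b) ->
  bijective_relation (fun (alpha : eqv_class eA) (beta : eqv_class eB) =>
    exists a b, [/\ alpha = class_of _ a, beta = class_of _ b & f a = g b]).
Proof.
move=> eAf eBg fg gf.
have classP T (e : T -> T -> Prop) (c : eqv_class e) : exists x, c = class_of e x.
  by case: c => c [x cE]; exists x; apply: eq_exist.
split=> [alpha|beta].
  have [a ->] := classP _ _ alpha; have [b fgb] := fg a.
  exists (class_of _ b); split; first by exists a, b.
  move=> _ [a' [b' [/(class_of_eq eAf) aa' -> fgb']]].
  by apply/(class_of_eq eBg); rewrite -fgb aa'.
have [b ->] := classP _ _ beta; have [a fga] := gf b.
exists (class_of _ a); split; first by exists a, b.
move=> _ [a' [b' [-> /(class_of_eq eBg) bb' fgb']]].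
by apply/(class_of_eq eAf); rewrite fga bb'.
Qed.

Theorem theorem5p2 (R : realType) (H : kreinSpace R) (S : set (H * H))
    (d : nat) (b : H * H -> 'cV[R[i]]_(2 * d)) (Q : 'M[R[i]]_(2 * d))
    (hd : (0 < d)%N)
    (hS : symmetric_relation S) (hSc : closed_relation S)
    (hdef : equal_defect S d)
    (hb : boundary_mapping S b) (hQ : gram_matrix S b Q) :
  bijective_relation (Xi S b Q).
Proof.
have -> : Xi S b Q = fun alpha beta => exists A P,
    [/\ alpha = class_of _ A, beta = class_of _ P & T_ext A = T_poly S b (sval P)].
  apply/funext => alpha; apply/funext => beta; apply/propext.
  split=> -[A [P [-> -> AP]]]; exists A, P; split=> //; first exact/funext.
  by move=> z; rewrite AP.
have Qherm : ctrans Q = Q by case: hQ.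
apply: (bijective_relation_of_invariant (f := @T_ext _ _ S)
    (g := fun P : {P | PQ Q P} => T_poly S b (sval P))).
- move=> A1 A2; split=> [A12|AA]; first by apply/funext => z; apply: ext_equiv_T.
  by apply: (T_ext_equiv hS hb hQ) => z; rewrite AA.
- move=> P1 P2; split=> [/(PQ_equivP hb) PP|PP]; first exact/funext.
  by apply/(PQ_equivP hb) => z; rewrite PP.
- move=> A; have [n [phi [G [Cc [E [F [KHG M rep]]]]]]] := extension_model hS hb hQ A.
  have [P [PQP shP]] := model_polynomial (Q_unit hQ) M; exists (exist _ P PQP).
  apply/funext => z; apply/seteqP; split=> y.
    by move=> /(T_extP z y KHG rep); rewrite (eqmxP (shP z)) => /T_polyP.
  by move=> /T_polyP /=; rewrite -(eqmxP (shP z)) => ?; apply/(T_extP z y KHG rep).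
move=> [P PQP]; have [n [G [Cc [E [F [M shP]]]]]] := polynomial_model (Q_unit hQ) Qherm PQP.
have [A TA] := model_extension hS hb hQ M; exists A.
apply/funext => z; apply/seteqP; split=> y.
  by move=> /TA; rewrite (eqmxP (shP z)) => /T_polyP.
by move=> /T_polyP /=; rewrite -(eqmxP (shP z)) => /TA.
Qed.
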